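(* Let $A\in\mathbb{R}^{n\times n}$, $B\in\mathbb{R}^{n\times1}$, $K\in\mathbb{R}^{1\times n}$ be such that $A+BK$ is Hurwitz, let $\hat D>0$ and $t_0\in\mathbb{R}$. Consider the closed-loop system consisting of the plant $$\dot X(t)=AX(t)+BU\big(t-\hat D-\delta(t)\big),$$ the observer $\hat D\hat u_t(x,t)=\hat u_x(x,t)$, $x\in[0,1]$, $\hat u(1,t)=U(t)$ (that is, $\hat u(x,t)=U(t+\hat D(x-1))$), and the control law $$U(t)=K\left(e^{A\hat D}X(t)+\int_{t-\hat D}^{t}e^{A(t-\theta)}BU(\theta)\,d\theta\right).$$ There exists a positive $\delta_1$ such that if the perturbation $\delta$ satisfies $$|\delta(t)|+|\delta'(t)|<\delta_1\qquad\text{for all }t\ge t_0,$$ then the closed-loop system is exponentially stable, in the sense that there exist positive constants $R$ and $\lambda$ such that $$\Pi_{\rm L}(t)\le R\,\Pi_{\rm L}(t_0)e^{-\lambda(t-t_0)}\qquad\text{for all }t\ge t_0,$$ where $$\Pi_{\rm L}(t)=|X(t)|^2+\int_{t-\hat D-\max\{0,\delta(t)\}}^{t}U(\theta)^2\,d\theta+\int_{t-\hat D}^{t}\dot U(\theta)^2\,d\theta .$$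
   Context: $X(t)\in\mathbb{R}^n$, $U(t)\in\mathbb{R}$; $|\cdot|$ is the Euclidean norm; $\delta:[t_0,\infty)\to\mathbb{R}$ is a continuously differentiable function of time only. Initial conditions are $X(t_0)$ and past values of $U$ on an interval ending at $t_0$ long enough for the delayed input and $\Pi_{\rm L}(t_0)$ to be defined; the estimate is for all solutions along which the quantities in $\Pi_{\rm L}$ are defined, with $R,\lambda$ independent of the solution. *)

(* Defs.v *)
From HB Require Import structures.
From mathcomp Require Import all_boot all_order all_algebra.
From mathcomp Require Import complex.
From mathcomp Require Import all_classical all_reals all_analysis.

Set Implicit Arguments.
Unset Strict Implicit.
Unset Printing Implicit Defensive.

Import Order.TTheory GRing.Theory Num.Theory.
Import numFieldNormedType.Exports.

Local Open Scope classical_set_scope.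
Local Open Scope ring_scope.

(* The library norm on matrices is the sup norm. *)
Definition enorm (R : realType) (n : nat) (x : 'cV[R]_n) : R :=
  Num.sqrt (\sum_(i < n) x i ord0 ^+ 2).

Definition expmx (R : realType) (n : nat) (A : 'M[R]_n) : 'M[R]_n :=
  limn (series (fun k : nat => (k`!%:R)^-1 *: A ^+ k)).

Definition hurwitz (R : realType) (n : nat) (A : 'M[R]_n) : Prop :=
  forall z : R[i], eigenvalue (map_mx (real_complex R) A) z ->
    complex.Re z < 0.

Definition integral_cv (R : realType) (n : nat) (D : set R)
    (f : R -> 'cV[R]_n) : 'cV[R]_n :=
  \col_i \int[lebesgue_measure]_(s in D) f s i ord0.

(* Derivative relative to a domain: it is one-sided at the left end point of
   `[a, +oo[. *)
Definition has_derivative_on (R : realType) (D : set R) (f : R -> R)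
    (t l : R) : Prop :=
  (f s - f t) / (s - t) @[s --> within D (t^')] --> l.

Definition C1_on (R : realType) (D : set R) (f f' : R -> R) : Prop :=
  (forall t, D t -> has_derivative_on D f t (f' t)) /\
  {within D, continuous f'}.

(* f is absolutely continuous on every `[a, b], i.e. f is there the indefinite
   Lebesgue integral of an integrable function g (and then g = derive1 f almost
   everywhere). Nothing is said about f on the left of a. *)
Definition loc_abs_continuous (R : realType) (a : R) (f : R -> R) : Prop :=
  exists g : R -> R, forall b, a <= b ->
    lebesgue_measure.-integrable `[a, b] (EFin \o g) /\
    f b = f a + \int[lebesgue_measure]_(s in `[a, b]) g s.

Definition square_integrable (R : realType) (D : set R) (f : R -> R) : Prop :=
  measurable_fun D f /\
  lebesgue_measure.-integrable D (EFin \o (fun s => f s ^+ 2)).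

(* Trajectories are total functions of time; only X on `[t0, +oo[ and U on
   `[t0 - Dh - Num.max 0 (delta t0), +oo[ are meant. The input is of class L^2
   there and of class H^1_loc on `[t0 - Dh, +oo[, which is what it takes for
   Pi_L to be defined, and the plant equation is understood in the sense of
   Caratheodory since the delayed input may be discontinuous. *)
Record closed_loop (R : realType) (n : nat) (A : 'M[R]_n) (B : 'cV[R]_n)
    (K : 'rV[R]_n) (Dh t0 : R) (delta : R -> R)
    (X : R -> 'cV[R]_n) (U : R -> R) (uh : R -> R -> R) : Prop := ClosedLoop {
  state_ac : forall i, loc_abs_continuous t0 (fun t => X t i ord0) ;
  input_ac : loc_abs_continuous (t0 - Dh) U ;
  input_L2 : forall t, t0 <= t ->
    square_integrable `[t - Dh - Num.max 0 (delta t), t] U ;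
  dinput_L2 : forall t, t0 <= t -> square_integrable `[t - Dh, t] (derive1 U) ;
  plant : {ae lebesgue_measure, forall t, t0 <= t ->
    is_derive t (1 : R) X (A *m X t + U (t - Dh - delta t) *: B)} ;
  (* The solution, by characteristics, of Dh * uh_t = uh_x on 0 <= x <= 1 with
     boundary value uh 1 t = U t, started from the recorded past of U. *)
  observer : forall t x, t0 <= t -> 0 <= x <= 1 ->
    uh x t = U (t + Dh * (x - 1)) ;
  control : forall t, t0 <= t ->
    U t = (K *m (expmx (Dh *: A) *m X t +
      integral_cv `[t - Dh, t]
        (fun s => U s *: (expmx ((t - s) *: A) *m B)))) ord0 ord0
}.

Definition Pi_L (R : realType) (n : nat) (Dh : R) (delta : R -> R)
    (X : R -> 'cV[R]_n) (U : R -> R) (t : R) : R :=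
  enorm (X t) ^+ 2
  + \int[lebesgue_measure]_(s in `[t - Dh - Num.max 0 (delta t), t]) (U s ^+ 2)
  + \int[lebesgue_measure]_(s in `[t - Dh, t]) (derive1 U s ^+ 2).

(* Main.v *)
(* With the predictor
     Z(t) = e^(A Dh) X(t) + int_(t - Dh)^t e^(A (t - s)) B U(s) ds
   the control law reads U = K Z, and the closed loop becomes
     Z' = (A + B K) Z + w e^(A Dh) B,  w(t) = U(t - Dh - delta(t)) - U(t - Dh).
   Let V be a quadratic Lyapunov function of the Hurwitz matrix A + B K.  After
   the transient [t0, t0 + 3 Dh] the mean value theorem bounds |w(t)| by
   sup |delta| times a constant times the maximum of |Z| on [t - 3 Dh, t], so for
   small delta the function e^(lambda t) V(Z(t)) decreases strictly at any time
   where it reaches a new maximum: it is bounded by its values on the transient.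
   During the transient the delayed input may only be square integrable; there
   Gronwall's inequality is applied to |X| + |U|, the delayed input being
   controlled by the change of variables s |-> s - Dh - delta(s).  The terms of
   Pi_L are then recovered from the decay of Z, since U = K Z, since X is a
   function of Z and of the past of U, and since U' = K Z' almost everywhere. *)

(* The mismatch [w] depends on a whole segment of the past, so [V(Z)] satisfies no differential
   inequality in its present value alone. The estimate is therefore made in the manner of
   Razumikhin, only at records of the weighted function, where the past is bounded by the present
   value up to the factor by which the weight changes over the window. Half of the decay rate [al]
   of [V] absorbs the mismatch; the other half is the final rate [al / 2]. The length [3 * Dh] has
   the following origin. [w(t)] is an increment of [U] over a time [|delta(t)|], and [U'] contains
   [w] again. As [|delta| <= Dh / 2], every [w] reaches back at most [3/2 * Dh], and this happens
   twice. Beyond [t0 + 3 * Dh] all these times lie after [t0], where [U = K Z]. The Lyapunov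
   function is an explicit sum of squares [|L x|^2], built from the factorization of the
   characteristic polynomial over the complex numbers. *)
Require Import Defs.
From mathcomp Require Import all_boot all_order all_algebra.
From mathcomp Require Import complex.
From mathcomp Require Import all_classical all_reals all_analysis.
From mathcomp Require Import measurable_realfun ring lra.
Set Implicit Arguments.
Unset Strict Implicit.
Unset Printing Implicit Defensive.
Import Order.TTheory GRing.Theory Num.Theory.
Import numFieldNormedType.Exports.
Local Open Scope classical_set_scope.
Local Open Scope ring_scope.

(** * Lyapunov functions of Hurwitz matrices *)

Section Lyapunov.
Variable R : realType.

Definition dotv (m : nat) (x y : 'cV[R]_m) : R := \sum_i x i 0 * y i 0.

Lemma dotvC m (x y : 'cV[R]_m) : dotv x y = dotv y x.
Proof. by apply: eq_bigr => i _; rewrite mulrC. Qed.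

Lemma dotvDr m (x y z : 'cV[R]_m) : dotv x (y + z) = dotv x y + dotv x z.
Proof. by rewrite -big_split; apply: eq_bigr => i _; rewrite mxE mulrDr. Qed.

Lemma dotvZr m a (x y : 'cV[R]_m) : dotv x (a *: y) = a * dotv x y.
Proof. by rewrite mulr_sumr; apply: eq_bigr => i _; rewrite mxE mulrCA. Qed.

Lemma dotvZl m a (x y : 'cV[R]_m) : dotv (a *: x) y = a * dotv x y.
Proof. by rewrite !(dotvC _ y) dotvZr. Qed.

Lemma dotv_ge0 m (x : 'cV[R]_m) : 0 <= dotv x x.
Proof. by apply: sumr_ge0 => i _; rewrite -expr2 sqr_ge0. Qed.

Lemma dotv_col m1 m2 (x1 y1 : 'cV[R]_m1) (x2 y2 : 'cV[R]_m2) :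
  dotv (col_mx x1 x2) (col_mx y1 y2) = dotv x1 y1 + dotv x2 y2.
Proof.
rewrite /dotv big_split_ord /=; congr (_ + _); apply: eq_bigr => i _.
  by rewrite !col_mxEu.
by rewrite !col_mxEd.
Qed.

Lemma dotv_young m (e : R) (x y : 'cV[R]_m) : 0 < e ->
  2 * dotv x y <= e * dotv x x + e^-1 * dotv y y.
Proof.
move=> e0; rewrite /dotv !mulr_sumr -big_split /=; apply: ler_sum => i _.
set a := x i 0; set b := y i 0.
rewrite -subr_ge0.
have -> : e * (a * a) + e^-1 * (b * b) - 2 * (a * b) = e^-1 * (e * a - b) ^+ 2.
  by field; rewrite gt_eqF.
by rewrite mulr_ge0 ?sqr_ge0// invr_ge0 ltW.
Qed.

(* Real and imaginary parts of the matrix product of the factors M - z. *)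
Fixpoint shift_prod (n : nat) (M : 'M[R]_n) (s : seq R[i]) : 'M[R]_n * 'M[R]_n :=
  if s is z :: s' then
    let: (P, Q) := shift_prod M s' in
    (M *m P - complex.Re z *: P + complex.Im z *: Q, M *m Q - complex.Re z *: Q - complex.Im z *: P)
  else (1%:M, 0).

Definition complex_mx (n : nat) (P : 'M[R]_n * 'M[R]_n) : 'M[R[i]]_n :=
  map_mx (real_complex R) P.1 + 'i%C *: map_mx (real_complex R) P.2.

Lemma complex_mx_eq0 n (P : 'M[R]_n * 'M[R]_n) : complex_mx P = 0 -> P.1 = 0 /\ P.2 = 0.
Proof.
move=> /matrixP P0; split; apply/matrixP => i j; have := P0 i j; rewrite !mxE;
  by move=> /eqP; rewrite eq_complex /= => /andP[/eqP h1 /eqP h2];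
     move: h1 h2; simpc => h1 h2; lra.
Qed.

Lemma complex_mx_shift n (M : 'M[R]_n) z s :
  complex_mx (shift_prod M (z :: s)) =
  (map_mx (real_complex R) M - z%:M) *m complex_mx (shift_prod M s).
Proof.
rewrite /=; case: shift_prod => P Q; rewrite /complex_mx /=.
rewrite mulmxBl !mulmxDr mul_scalar_mx -!scalemxAr -!map_mxM.
rewrite mul_scalar_mx scalerA.
apply/matrixP => i j; rewrite !mxE.
set u := \sum_j0 _; set v := \sum_j0 _.
case: z => a b; rewrite /real_complex_def.
by apply/eqP; rewrite eq_complex /=; apply/andP; split; apply/eqP; ring.
Qed.

Lemma shift_prod_comm n (M : 'M[R]_n) s : let: (P, Q) := shift_prod M s in
  P *m M = M *m P /\ Q *m M = M *m Q.
Proof.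
elim: s => [|z s] /=; first by rewrite mul1mx mulmx1 mul0mx mulmx0.
case: shift_prod => P Q [hP hQ]; split.
  by rewrite mulmxDl mulmxDr mulmxBl mulmxBr -!scalemxAl -!scalemxAr -mulmxA hP hQ.
by rewrite !mulmxBl !mulmxBr -!scalemxAl -!scalemxAr -mulmxA hP hQ.
Qed.

(** The characteristic polynomial splits over [R[i]]; its roots are eigenvalues, and by
    Cayley-Hamilton the product of the factors [M - z] vanishes, so both its real and its imaginary
    part do. *)
Lemma hurwitz_shift_prod n (M : 'M[R]_n) : hurwitz M ->
  exists s, (forall z, z \in s -> complex.Re z < 0) /\ shift_prod M s = (0, 0).
Proof.
case: n M => [|n] M HM.
  (* In dimension 0 the identity is already zero, so the empty product serves. *)
  exists [::]; split => //=; congr pair; exact: flatmx0.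
set Mc := map_mx (real_complex R) M.
have [s Ds] := closed_field_poly_normal (char_poly Mc).
have mchar : lead_coef (char_poly Mc) = 1 by apply/monicP; exact: char_poly_monic.
rewrite mchar scale1r in Ds.
exists s; split.
  move=> z zs; apply: HM; rewrite eigenvalue_root_char Ds.
  by rewrite root_prod_XsubC.
suff /complex_mx_eq0 : complex_mx (shift_prod M s) = 0.
  by case: shift_prod => P Q /= [-> ->].
have := Cayley_Hamilton Mc; rewrite Ds => <-.
elim: {Ds} s => [|z s IH].
  rewrite big_nil rmorph1 /complex_mx /= map_scalar_mx /= map_mx0 scaler0 addr0.
  by rewrite rmorph1.
by rewrite complex_mx_shift IH big_cons rmorphM rmorphB /= horner_mx_X horner_mx_C.
Qed.

(* Along x' = M x the vector y = P x + i Q x solves y' = z y + y1, where y1 is the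
   next shifted product applied to x; hence adding a large multiple of |y|^2
   absorbs the remainder c |y|^2 at the cost of a multiple of |y1|^2. *)
Lemma shift_prod_lyapunov n (M : 'M[R]_n) s : (forall z, z \in s -> complex.Re z < 0) ->
  exists m (L : 'M[R]_(m, n)) (al c : R), [/\ 0 < al, 0 <= c &
  forall x : 'cV[R]_n, let: (P, Q) := shift_prod M s in
    let r := dotv (P *m x) (P *m x) + dotv (Q *m x) (Q *m x) in
    dotv x x <= dotv (L *m x) (L *m x) + r /\
    2 * dotv (L *m x) (L *m (M *m x)) <=
      - al * dotv (L *m x) (L *m x) + c * r].
Proof.
elim: s => [|z s IH] Hs.
  (* Without factors the remainder [r] is [|x|^2] itself, and the quadratic form is the one of an
     empty [L]. *)
  exists 0, 0, 1, 0; split => // x /=; rewrite !mul0mx mul1mx.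
  have d0 : forall y z : 'cV[R]_0, dotv y z = 0 by move=> *; rewrite /dotv big_ord0.
  by rewrite !d0 mul0r !mulr0 addr0 add0r lerDl dotv_ge0.
have [|m [L [al [c [al0 c0 HL]]]]] := IH.
  by move=> y ys; apply: Hs; rewrite inE ys orbT.
have za : complex.Re z < 0 by apply: Hs; rewrite inE eqxx.
move: HL (shift_prod_comm M s) => /=; case: (shift_prod M s) => P Q HL [cP cQ].
set a := complex.Re z in za *; set b := complex.Im z.
(* This weight gives [k * a = a - 2 * c]. Young's inequality with weight [- a] spends half of the
   decay [2 * k * a * r]; the other half absorbs [c * r] from the induction and still leaves the
   rate [- a / 2]. The factor [q] is a square root of [k] because the form is stored as
   [|L x|^2]. *)
pose k : R := 1 + 2 * c / (- a).
have k1 : 1 <= k by rewrite lerDl divr_ge0 ?mulr_ge0// oppr_ge0 ltW.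
have k0 : 0 < k by apply: lt_le_trans k1.
pose q := Num.sqrt k.
have qq : q * q = k by rewrite -expr2 sqr_sqrtr// ltW.
exists (m + (n + n))%N, (col_mx L (col_mx (q *: P) (q *: Q))).
exists (Num.min al (- a / 2)), (k / (- a)); split.
- by rewrite lt_min al0 divr_gt0// oppr_gt0.
- by rewrite divr_ge0 ?oppr_ge0 ?ltW.
move=> x; have [HL1 HL2] := HL x.
rewrite !mul_col_mx !dotv_col -!scalemxAl !dotvZl !dotvZr.
set Px := P *m x; set Qx := Q *m x.
set y1 := ((M *m P - _ + _) *m x); set y2 := ((M *m Q - _ - _) *m x).
have e1 : P *m (M *m x) = y1 + a *: Px - b *: Qx.
  rewrite mulmxA cP /y1 mulmxDl mulmxBl -!scalemxAl -/Px -/Qx.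
  by move: (M *m P *m x) (a *: Px) (b *: Qx) => u v w; apply/matrixP => i j; rewrite !mxE; ring.
have e2 : Q *m (M *m x) = y2 + a *: Qx + b *: Px.
  rewrite mulmxA cQ /y2 !mulmxBl -!scalemxAl -/Px -/Qx.
  by move: (M *m Q *m x) (a *: Qx) (b *: Px) => u v w; apply/matrixP => i j; rewrite !mxE; ring.
rewrite e1 e2 -!scaleNr !dotvDr !dotvZr (dotvC Qx Px) !(mulrA q) !qq.
have Px0 := dotv_ge0 Px; have Qx0 := dotv_ge0 Qx.
have V0 := dotv_ge0 (L *m x).
have za' : 0 < - a by rewrite oppr_gt0.
have yP := dotv_young Px y1 za'; have yQ := dotv_young Qx y2 za'.
move: HL1 HL2; rewrite -/Px -/Qx.
move: (dotv Px Px) (dotv Qx Qx) (dotv Px y1) (dotv Qx y2) (dotv y1 y1)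
  (dotv y2 y2) (dotv Px Qx) (dotv (L *m x) (L *m x)) (dotv (L *m x) (L *m (M *m x))) Px0 Qx0 V0 yP yQ (dotv_ge0 y1) (dotv_ge0 y2).
move=> pp qx py qy yy1 yy2 pq V dV pp0 qx0 V0 yP yQ yy10 yy20 HL1 HL2.
have r0 : 0 <= pp + qx by rewrite addr_ge0.
split; first by have := ler_wpM2r r0 k1; lra.
set r := pp + qx in r0 HL1 HL2 *.
have ka : k * a = a - 2 * c by rewrite /k; field; rewrite lt_eqF.
have kr : 2 * (k * (py + a * pp - b * pq) + k * (qy + a * qx + b * pq)) <=
    (a - 2 * c) * r + k / - a * (yy1 + yy2).
  have -> : 2 * (k * (py + a * pp - b * pq) + k * (qy + a * qx + b * pq)) =
    k * (2 * py + 2 * qy) + 2 * (k * a) * r by rewrite /r; ring.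
  apply: (@le_trans _ _ (k * ((- a * pp + (- a)^-1 * yy1) +
      (- a * qx + (- a)^-1 * yy2)) + 2 * (k * a) * r)).
    by rewrite lerD2r; apply: ler_wpM2l; [exact: ltW | exact: lerD].
  by rewrite le_eqVlt -ka /r; apply/orP; left; apply/eqP; ring.
have mV : Num.min al (- a / 2) * V <= al * V by rewrite ler_wpM2r// ge_min lexx.
have mr : Num.min al (- a / 2) * (k * r) <= (- a / 2) * (k * r).
  by rewrite ler_wpM2r ?ge_min ?lexx ?orbT// mulr_ge0// ltW.
have e3 : (- a / 2) * (k * r) = - (k * a) * r / 2 by ring.
rewrite ka in e3.
have ar : a * r <= 0 by rewrite mulr_le0_ge0// ltW.
rewrite /r in kr mr e3 ar HL2; lra.
Qed.

(** For the full product of factors the remainder is zero, so the estimates for the partial products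
    become those of a Lyapunov function. *)
Lemma hurwitz_lyapunov n (M : 'M[R]_n) : hurwitz M ->
  exists m (L : 'M[R]_(m, n)) (al : R), 0 < al /\ forall x : 'cV[R]_n,
    dotv x x <= dotv (L *m x) (L *m x) /\
    2 * dotv (L *m x) (L *m (M *m x)) <= - al * dotv (L *m x) (L *m x).
Proof.
move=> /hurwitz_shift_prod [s [/shift_prod_lyapunov HL s0]].
have [m [L [al [c [al0 _ {}HL]]]]] := HL _ M.
exists m, L, al; split => // x; have := HL x; rewrite s0 !mul0mx.
have -> : dotv (0 : 'cV[R]_n) 0 = 0.
  by rewrite /dotv big1// => i _; rewrite mxE mul0r.
by rewrite /= !addr0 mulr0 addr0.
Qed.
End Lyapunov.

(** * Matrix exponential *)

Section MatrixCalculus.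
Variable R : realType.

Lemma is_derive_ext (f g : R -> R) t d : f =1 g ->
  is_derive t (1 : R) f d -> is_derive t (1 : R) g d.
Proof. by move=> /funext ->. Qed.

Lemma is_derive_sum_fun n (h : 'I_n -> R -> R) (d : 'I_n -> R) t :
  (forall i, is_derive t (1 : R) (h i) (d i)) ->
  is_derive t (1 : R) (fun s => \sum_i h i s) (\sum_i d i).
Proof.
move=> H; apply: is_derive_ext (is_derive_sum H) => s.
by rewrite fct_sumE.
Qed.

Lemma is_derive_mul_fun (f g : R -> R) t df dg :
  is_derive t (1 : R) f df -> is_derive t (1 : R) g dg ->
  is_derive t (1 : R) (fun s => f s * g s) (df * g t + f t * dg).
Proof.
move=> hf hg; apply: is_derive_eq (is_deriveM hf hg) _.
by rewrite addrC /GRing.scale/= (mulrC df).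
Qed.

(** Entrywise differentiation reduces products of rectangular matrices to scalar calculus. *)
Definition mderiv m p (F : R -> 'M[R]_(m, p)) t (dF : 'M[R]_(m, p)) :=
  forall i j, is_derive t (1 : R) (fun s => F s i j) (dF i j).

Lemma mderiv_eq m p (F : R -> 'M[R]_(m, p)) t d d' :
  mderiv F t d -> d = d' -> mderiv F t d'.
Proof. by move=> H <-. Qed.

Lemma mderiv_cst m p (M : 'M[R]_(m, p)) t : mderiv (fun=> M) t 0.
Proof. by move=> i j; rewrite mxE; exact: is_derive_cst. Qed.

Lemma mderivD m p (F G : R -> 'M[R]_(m, p)) t dF dG :
  mderiv F t dF -> mderiv G t dG -> mderiv (fun s => F s + G s) t (dF + dG).
Proof.
move=> hF hG i j; rewrite mxE.
by apply: is_derive_ext (is_deriveD (hF i j) (hG i j)) => s; rewrite mxE.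
Qed.

Lemma mderivN m p (F : R -> 'M[R]_(m, p)) t dF :
  mderiv F t dF -> mderiv (fun s => - F s) t (- dF).
Proof.
move=> hF i j; rewrite mxE.
by apply: is_derive_ext (is_deriveN (hF i j)) => s; rewrite mxE.
Qed.

Lemma mderivM m p q (F : R -> 'M[R]_(m, p)) (G : R -> 'M[R]_(p, q)) t dF dG :
  mderiv F t dF -> mderiv G t dG ->
  mderiv (fun s => F s *m G s) t (dF *m G t + F t *m dG).
Proof.
move=> hF hG i j; rewrite !mxE -big_split /=.
apply: (@is_derive_ext (fun s => \sum_k F s i k * G s k j)).
  by move=> s; rewrite mxE.
by apply: is_derive_sum_fun => k; exact: is_derive_mul_fun.
Qed.

Lemma mderivMl m p q (M : 'M[R]_(m, p)) (G : R -> 'M[R]_(p, q)) t dG :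
  mderiv G t dG -> mderiv (fun s => M *m G s) t (M *m dG).
Proof.
move=> hG; apply: mderiv_eq (mderivM (mderiv_cst M t) hG) _.
by rewrite mul0mx add0r.
Qed.

Lemma mderiv_comp m p (F : R -> 'M[R]_(m, p)) (g : R -> R) t dF dg :
  mderiv F (g t) dF -> is_derive t (1 : R) g dg ->
  mderiv (F \o g) t (dg *: dF).
Proof.
move=> hF hg i j; rewrite mxE mulrC.
exact: (@is_derive1_comp _ (fun s => F s i j) g t _ _ (hF i j) hg).
Qed.

Lemma mderiv0_cst m p (F : R -> 'M[R]_(m, p)) :
  (forall t, mderiv F t 0) -> forall s t, F s = F t.
Proof.
move=> H s t; apply/matrixP => i j.
apply: (is_derive_0_is_cst (f := fun s => F s i j)) => x.
by have := H x i j; rewrite mxE.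
Qed.

Lemma cvg_sum_fun (T : Type) (G : set_system T) n (h : 'I_n -> T -> R) (l : 'I_n -> R) :
  Filter G -> (forall i, h i @ G --> l i) ->
  (fun s => \sum_i h i s) @ G --> \sum_i l i.
Proof.
move=> FG; elim: n h l => [|n IH] h l H.
  rewrite big_ord0 (_ : (fun s => _) = cst 0); first exact: cvg_cst.
  by apply/funext => s; rewrite big_ord0.
rewrite big_ord_recr (_ : (fun s => _) =
  (fun s => (\sum_(i < n) h (widen_ord (leqnSn n) i) s) + h ord_max s)).
  by apply: cvgD => //; exact: IH.
by apply/funext => s; rewrite big_ord_recr.
Qed.

Lemma cvg_mx m p (T : Type) (G : set_system T) (F : T -> 'M[R]_(m, p)) (M : 'M[R]_(m, p)) : Filter G ->
  (forall i j, (fun s => F s i j) @ G --> M i j) -> F @ G --> M.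
Proof.
move=> FG H; apply/cvgrPdist_le => /= e e0.
near=> x.
rewrite /Num.Def.normr/= mx_normrE (bigmax_le _ (ltW e0))//= => i _.
rewrite !mxE/=.
move: i; near: x; apply: filter_forall => /= i.
exact: ((cvgrPdist_le _ _).1 (H i.1 i.2)).
Unshelve. all: by end_near. Qed.

End MatrixCalculus.

Section MatrixExponential.
Variables (R : realType) (n : nat) (A : 'M[R]_n).

Let E (t : R) := expmx (t *: A).
Let nA := \sum_i \sum_j `|A i j|.
Let coef i j (k : nat) : R := (A ^+ k) i j / k`!%:R.

Lemma expr_entry_le k i j : `|(A ^+ k) i j| <= nA ^+ k.
Proof.
elim: k i j => [|k IH] i j.
  by rewrite !expr0 mxE; case: (i == j); rewrite ?normr1 ?normr0.
rewrite !exprS mxE (le_trans (ler_norm_sum _ _ _))//.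
apply: (@le_trans _ _ (\sum_l `|A i l| * nA ^+ k)).
  by apply: ler_sum => l _; rewrite normrM ler_wpM2l.
rewrite -mulr_suml ler_wpM2r ?exprn_ge0//.
  by apply: sumr_ge0 => *; apply: sumr_ge0.
by rewrite /nA [leRHS](bigD1 i)//= lerDl sumr_ge0// => *; apply: sumr_ge0.
Qed.

(** Comparison with the exponential series. It serves the entries of [e^(A t)] and their first two
    formal derivatives, which termwise differentiation asks for. *)
Lemma cvg_pseries_exp_bound (a : R^nat) C c x : (forall k, `|a k| <= C * (c ^+ k / k`!%:R)) ->
  0 <= c -> cvgn (pseries a x).
Proof.
move=> Ha c0; apply: normed_cvg.
have : cvgn (series (C *: exp_coeff (c * `|x|))).
  by apply: is_cvg_seriesZ; exact: is_cvg_series_exp_coeff.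
have le k : `|a k * x ^+ k| <= (C *: exp_coeff (c * `|x|)) k.
  rewrite normrM normrX /exp_coeff/= /GRing.scale/=.
  apply: (@le_trans _ _ (C * (c ^+ k / k`!%:R) * `|x| ^+ k)).
    by rewrite ler_wpM2r// exprn_ge0.
  by rewrite exprMn -!mulrA (mulrC _^-1).
apply: series_le_cvg => k; [exact: normr_ge0 | | exact: le].
exact: le_trans (normr_ge0 _) (le k).
Qed.

Let dcoef i j (k : nat) : R := (A ^+ k.+1) i j / k`!%:R.

Lemma coef_le i j k : `|coef i j k| <= 1 * (nA ^+ k / k`!%:R).
Proof.
rewrite mul1r /coef normrM normfV (ger0_norm (ler0n _ _)) ler_wpM2r ?expr_entry_le// invr_ge0.
Qed.

Lemma pseries_diffs_coef i j : pseries_diffs (coef i j) = dcoef i j.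
Proof.
apply/funext => k; rewrite /pseries_diffs /coef /dcoef factS natrM.
by rewrite mulrA [_ * (A ^+ _) _ _]mulrC -mulrA invfM (mulrA k.+1%:R) divff ?mul1r ?pnatr_eq0.
Qed.

Lemma dcoef_le i j k : `|dcoef i j k| <= nA * (nA ^+ k / k`!%:R).
Proof.
rewrite /dcoef mulrA -exprS normrM normfV (ger0_norm (ler0n _ _)) ler_wpM2r ?expr_entry_le// invr_ge0.
Qed.

Lemma ddcoef_le i j k : `|pseries_diffs (dcoef i j) k| <= nA ^+ 2 * (nA ^+ k / k`!%:R).
Proof.
have -> : pseries_diffs (dcoef i j) k = (A ^+ k.+2) i j / k`!%:R.
  rewrite /pseries_diffs /dcoef factS natrM.
  by rewrite mulrA [_ * (A ^+ _) _ _]mulrC -mulrA invfM (mulrA k.+1%:R) divff ?mul1r ?pnatr_eq0.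
rewrite mulrA -exprD add2n normrM normfV (ger0_norm (ler0n _ _)) ler_wpM2r ?expr_entry_le// invr_ge0.
Qed.

Lemma nA_ge0 : 0 <= nA.
Proof. by apply: sumr_ge0 => i _; apply: sumr_ge0. Qed.

Lemma expmx_cvg t :
  series (fun k : nat => (k`!%:R)^-1 *: (t *: A) ^+ k) @ \oo -->
  (\matrix_(i, j) limn (pseries (coef i j) t) : 'M[R]_n).
Proof.
apply: cvg_mx => i j; rewrite mxE.
rewrite (_ : (fun s => _) = pseries (coef i j) t).
  exact: cvg_pseries_exp_bound (coef_le i j) nA_ge0.
apply/funext => m; rewrite /pseries /series/= summxE; apply: eq_bigr => k _.
have -> : (t *: A) ^+ k = t ^+ k *: A ^+ k.
  elim: k => [|k IH]; first by rewrite !expr0 scale1r.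
  rewrite !exprS IH -[LHS]/((t *: A) *m (t ^+ k *: A ^+ k)).
  by rewrite -scalemxAl -scalemxAr scalerA.
by rewrite !mxE /coef; ring.
Qed.

Lemma expmx_entry t i j : E t i j = limn (pseries (coef i j) t).
Proof.
by rewrite /E /expmx (cvg_lim (@norm_hausdorff _ _) (@expmx_cvg t)) mxE.
Qed.

Lemma lim_dcoefl t i j : limn (pseries (dcoef i j) t) = (A *m E t) i j.
Proof.
apply/cvg_lim; first exact: norm_hausdorff.
rewrite mxE (_ : pseries _ _ = (fun m => \sum_l A i l * pseries (coef l j) t m)).
  apply: cvg_sum_fun => l; apply: cvgMr; rewrite expmx_entry.
  exact: cvg_pseries_exp_bound (coef_le l j) nA_ge0.
apply/funext => m; rewrite /pseries /series/=.
under [RHS]eq_bigr do rewrite mulr_sumr.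
rewrite exchange_big/=; apply: eq_bigr => k _.
rewrite /dcoef exprS mxE !mulr_suml; apply: eq_bigr => l _.
by rewrite /coef !mulrA.
Qed.

Lemma lim_dcoefr t i j : limn (pseries (dcoef i j) t) = (E t *m A) i j.
Proof.
apply/cvg_lim; first exact: norm_hausdorff.
rewrite mxE (_ : pseries _ _ = (fun m => \sum_l pseries (coef i l) t m * A l j)).
  apply: cvg_sum_fun => l; apply: cvgMl; rewrite expmx_entry.
  exact: cvg_pseries_exp_bound (coef_le i l) nA_ge0.
apply/funext => m; rewrite /pseries /series/=.
under [RHS]eq_bigr do rewrite mulr_suml.
rewrite exchange_big/=; apply: eq_bigr => k _.
rewrite /dcoef exprSr mxE !mulr_suml; apply: eq_bigr => l _.
by rewrite /coef; ring.
Qed.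

(** [A ^+ k.+1] splits off a factor [A] on either side, so both products are the limit of the same
    differentiated series. *)
Lemma expmx_comm t : E t *m A = A *m E t.
Proof. by apply/matrixP => i j; rewrite -lim_dcoefl -lim_dcoefr. Qed.

Lemma mderiv_expmx t : mderiv E t (A *m E t).
Proof.
move=> i j; rewrite -lim_dcoefl -pseries_diffs_coef.
apply: (@is_derive_ext _ (fun x => limn (pseries (coef i j) x))).
  by move=> s; rewrite expmx_entry.
apply: (@pseries_snd_diffs _ _ (`|t| + 1)).
- exact: cvg_pseries_exp_bound (coef_le i j) nA_ge0.
- rewrite pseries_diffs_coef.
  exact: cvg_pseries_exp_bound (dcoef_le i j) nA_ge0.
- rewrite pseries_diffs_coef.
  exact: cvg_pseries_exp_bound (ddcoef_le i j) nA_ge0.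
- by rewrite [ltRHS]ger0_norm ?addr_ge0// ltrDl.
Qed.

Lemma expmx0 : E 0 = 1%:M.
Proof.
apply/matrixP => i j; rewrite expmx_entry.
apply: lim_near_cst; first exact: norm_hausdorff.
near=> m; rewrite /pseries /series/=.
have m0 : (0 < m)%N by near: m; exact: nbhs_infty_gt.
rewrite big_mkord -(prednK m0) big_ord_recl big1 ?addr0.
  by rewrite /coef !expr0 fact0 mulr1 divr1.
by move=> k _; rewrite expr0n mulr0.
Unshelve. all: by end_near. Qed.

Lemma mderiv_expmx_opp c t : mderiv (fun s => E (c - s)) t (- (A *m E (c - t))).
Proof.
have h : is_derive t (1 : R) (fun s : R => c - s) (- 1).
  apply: is_derive_eq (is_deriveB (is_derive_cst c t 1) (is_derive_id t 1)) _.
  by rewrite sub0r.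
have := @mderiv_comp R n n E (fun s => c - s) t _ _ (mderiv_expmx (c - t)) h.
by rewrite scaleN1r.
Qed.

(** By commutation [e^(A x) e^(A (s + t - x))] has zero derivative in [x]; its values at [0] and [s]
    are compared. *)
Lemma expmxD s t : E (s + t) = E s *m E t.
Proof.
pose F x := E x *m E (s + t - x).
have FE : forall x y, F x = F y.
  apply: mderiv0_cst => x.
  apply: mderiv_eq (mderivM (mderiv_expmx x) (mderiv_expmx_opp (s + t) x)) _.
  by rewrite mulmxN mulmxA expmx_comm subrr.
have := FE 0 s; rewrite /F subr0 expmx0 mul1mx => ->.
by congr (_ *m E _); rewrite addrAC subrr add0r.
Qed.
End MatrixExponential.

(** * Integrals along an expanding map *)

Section ChangeOfVariables.
Variable R : realType.
Notation mu := (@lebesgue_measure R).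
Variables (phi : R -> R) (k : R).
Hypothesis k0 : 0 < k.
Hypothesis phi_expanding : forall s t, s <= t -> t - s <= k * (phi t - phi s).
Hypothesis mphi : measurable_fun setT phi.

(** Two points of the preimage are at most [k * (b - a)] apart, so it lies in an interval of that
    length starting at its infimum. *)
Lemma preimage_itv_measure (a b : R) : a <= b ->
  (mu (phi @^-1` `]a, b]) <= (k * (b - a))%:E)%E.
Proof.
move=> ab; set S := phi @^-1` _.
have mS : measurable S.
  by rewrite /S -[X in measurable X]setTI; apply: mphi.
have [S0|/set0P[s0 Ss0]] := eqVneq S set0; first by rewrite S0 measure0 lee_fin mulr_ge0 ?subr_ge0// ltW.
have SS s t : S s -> S t -> s - k * (b - a) <= t.
  rewrite /S/= !in_itv/= => /andP[as1 sb] /andP[a1t tb].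
  have [st|ts] := leP s t.
    have : 0 <= k * (b - a) by rewrite mulr_ge0 ?subr_ge0// ltW.
    lra.
  have := phi_expanding (ltW ts).
  have : k * (phi s - phi t) <= k * (b - a) by rewrite ler_wpM2l ?ltW//; lra.
  lra.
have lS : has_lbound S by exists (s0 - k * (b - a)) => t; exact: SS.
have subS : S `<=` `[inf S, inf S + k * (b - a)].
  move=> s Ss /=; rewrite in_itv/= ge_inf//= -lerBlDr.
  by apply: lb_le_inf; [exists s0|move=> t; exact: SS].
apply: (@le_trans _ _ (mu `[inf S, inf S + k * (b - a)])).
  by apply: le_measure; rewrite ?inE.
rewrite lebesgue_measure_itv/= lte_fin; case: ifP => _.
  by rewrite -EFinB lee_fin addrAC subrr add0r.
by rewrite lee_fin mulr_ge0 ?subr_ge0// ltW.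
Qed.

(* The Lebesgue measure is the outer measure generated by intervals, so it is
   enough to measure preimages of intervals. *)
Lemma preimage_measure (E : set R) : measurable E ->
  (mu (phi @^-1` E) <= k%:E * mu E)%E.
Proof.
move=> mE; rewrite -lee_pdivrMl//.
rewrite [leRHS]/lebesgue_measure/= /lebesgue_stieltjes_measure/= /measure_extension.
apply: le_ereal_inf_tmp => x [A [mA EA] <-{x}].
rewrite lee_pdivrMl//.
have mpre (i : nat) : measurable (phi @^-1` (A i)).
  rewrite -[X in measurable X]setTI; apply: mphi => //.
  by have [[u v] _ <-] := mA i; exact: measurable_itv.
apply: (@le_trans _ _ (\sum_(i <oo) mu (phi @^-1` (A i)))%E).
  apply: (@measure_sigma_subadditive _ _ _ mu (phi @^-1` E) (fun i => phi @^-1` A i)).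
  - exact: mpre.
  - by rewrite -[X in measurable X]setTI; exact: mphi.
  by move=> s /= Es; have [i _ Ai] := EA _ Es; exists i.
rewrite -nneseriesZl//.
apply: lee_nneseries => // i _.
have [[u v] _ <-] := mA i.
rewrite /= wlength_itv/= lte_fin; case: ltP => uv.
  by rewrite -EFinB -EFinM preimage_itv_measure// ltW.
by rewrite set_itv_ge ?preimage_set0 ?measure0 ?mule0// bnd_simp -leNgt.
Qed.

(** The bound on preimages says that the image of the Lebesgue measure under [phi] is at most [k]
    times the Lebesgue measure; integrals of nonnegative functions compare accordingly. No
    derivative of [phi] enters. *)
Lemma ge0_integral_expanding (D : set R) (f : R -> R) :
  measurable D -> measurable_fun D f -> (forall y, D y -> 0 <= f y) ->
  (\int[mu]_(x in phi @^-1` D) (f (phi x))%:E <= k%:E * \int[mu]_(y in D) (f y)%:E)%E.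
Proof.
move=> mD mf f0.
have mphi' : @measurable_fun _ _ (measurableTypeR R) (measurableTypeR R) setT phi.
  exact: mphi.
have f0' : {in D, forall y, 0%E <= (EFin \o f) y}%E.
  by move=> y /set_mem Dy; rewrite lee_fin f0.
rewrite -(ge0_integral_pushforward mphi' mu mD _ f0')//; last first.
  by apply/measurable_EFinP.
pose kn := NngNum (ltW k0).
have -> : (k%:E * \int[mu]_(y in D) (f y)%:E =
    \int[mscale kn mu]_(y in D) (f y)%:E)%E.
  by rewrite ge0_integral_mscale//; apply/measurable_EFinP.
have H : (\int[@pushforward _ _ (measurableTypeR R) (measurableTypeR R) R mu phi]_x
    ((EFin \o f) \_ D) x <= \int[mscale kn mu]_x ((EFin \o f) \_ D) x)%E.
  have H0 := @ge0_le_measure_integral _ (measurableTypeR R) R (@pushforward _ _ (measurableTypeR R) (measurableTypeR R) R mu phi)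
    (mscale kn mu).
  apply: (H0 mphi') => //.
  - by move=> S mS; rewrite /mscale/=; exact: preimage_measure.
  - by apply: erestrict_ge0 => y Dy; rewrite lee_fin f0.
  - by apply/(measurable_restrictT _ _).1 => //; apply/measurable_EFinP.
rewrite integral_mkcond [leRHS]integral_mkcond.
exact: H.
Qed.
End ChangeOfVariables.

(** * Real analysis *)

Section RealAnalysis.
Variable R : realType.
Notation mu := (@lebesgue_measure R).
Implicit Types (f g : R -> R) (a b t : R).

Lemma Rintegral_le_subset (A D : set R) f : measurable A -> measurable D -> A `<=` D ->
  mu.-integrable D (EFin \o f) -> (forall x, D x -> 0 <= f x) ->
  \int[mu]_(x in A) f x <= \int[mu]_(x in D) f x.
Proof.
move=> mA mD AD iD f0; rewrite /Rintegral fine_le//.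
- by apply: integrable_fin_num => //; exact: integrableS iD.
- exact: integrable_fin_num.
- apply: ge0_subset_integral => //; first by case/integrableP: iD.
Qed.

Lemma Rintegral_itv_split f a b c : a <= b -> b <= c ->
  mu.-integrable `[a, c] (EFin \o f) ->
  \int[mu]_(x in `[a, c]) f x = \int[mu]_(x in `[a, b]) f x + \int[mu]_(x in `[b, c]) f x.
Proof.
move=> ab bc ic.
have := @Rintegral_itvB R f (BLeft a) (BRight c) b ic.
rewrite !bnd_simp => /(_ ab bc) E; rewrite -[LHS](subrK (\int[mu]_(x in `[a, b]) f x)) E.
rewrite addrC Rintegral_itv_obnd_cbnd//.
apply: integrableS ic => // x /=; rewrite !in_itv/= => /andP[bx xc].
by rewrite xc andbT (le_trans ab)// ltW.
Qed.

(** Trajectories are meaningful only from some time on. Freezing the argument there yields a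
    function continuous on the whole line with the same values on the half-line. *)
Lemma continuous_clamp a f : {within `[a, +oo[, continuous f} ->
  continuous (fun t => f (Num.max a t)).
Proof.
move=> /subspace_continuousP cf t.
have Dm : `[a, +oo[%classic (Num.max a t) by rewrite /= in_itv/= andbT le_max lexx.
apply: (@cvg_comp _ _ _ (Num.max a) f _ (within `[a, +oo[ (nbhs (Num.max a t)))); last exact: cf.
move=> A; rewrite /within /= => nA.
have cm : {for t, continuous (Num.max a : R -> R)}.
  by apply: (@continuous_max _ _ (cst a) id t); [exact: cst_continuous|].
have cm' : nbhs t [set s | `[a, +oo[%classic (Num.max a s) -> A (Num.max a s)] := cm _ nA.
apply: filterS cm' => s; apply.
by rewrite /= in_itv/= andbT le_max lexx.
Qed.

Lemma ac_within_continuous a f : loc_abs_continuous a f -> {within `[a, +oo[, continuous f}.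
Proof.
move=> [g Hg].
have cb b : a < b -> {within `[a, b], continuous f}.
  move=> ab; have [ig _] := Hg b (ltW ab).
  have := parameterized_integral_continuous (ltW ab) ig.
  move=> /subspace_continuousP H; apply/subspace_continuousP => x xab.
  have /= Hx := H x xab.
  have E : forall s, `[a, b]%classic s -> f s = f a + \int[mu]_(x in `[a, s]) g x.
    by move=> s; rewrite /= in_itv/= => /andP[as_ _]; case: (Hg s as_).
  have Efx := E x xab.
  suff : f @ within `[a, b] (nbhs x) --> f x by [].
  rewrite Efx.
  have : (fun s => f a + \int[mu]_(x in `[a, s]) g x) @ within `[a, b] (nbhs x)
      --> f a + \int[mu]_(x in `[a, x]) g x.
    by apply: cvgD => //; exact: cvg_cst.
  apply: cvg_trans; apply: near_eq_cvg; rewrite near_withinE; near=> s => sab.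
  by rewrite (E s sab).
apply/continuous_within_itvcyP; split.
  move=> x; rewrite in_itv/= andbT => ax.
  have ax1 : a < x + 1 by rewrite (lt_trans ax)// ltrDl.
  apply: (within_continuous_continuous ax1 (cb _ ax1)).
  by rewrite in_itv/= ax ltrDl ltr01.
have a1 : a < a + 1 by rewrite ltrDl.
by have /(continuous_within_itvP _ a1)[] := cb _ a1.
Unshelve. all: by end_near. Qed.

Lemma continuous_integrable_itv a b f : continuous f -> mu.-integrable `[a, b] (EFin \o f).
Proof.
move=> cf; apply: continuous_compact_integrable; first exact: segment_compact.
exact: continuous_subspaceT.
Qed.

(** The density provided by absolute continuity is arbitrary; by Lebesgue differentiation it equals
    almost everywhere any [g] that is almost everywhere the derivative, and [g] inherits
    integrability and the integral formula. *)
Lemma ac_integral a f g : loc_abs_continuous a f ->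
  {ae mu, forall t, a <= t -> is_derive t (1 : R) f (g t)} ->
  (forall b, a <= b -> measurable_fun `[a, b] g) ->
  forall b, a <= b -> mu.-integrable `[a, b] (EFin \o g) /\
    f b = f a + \int[mu]_(s in `[a, b]) g s.
Proof.
move=> [h Hh] df mg b ab.
have FF : Filter (nbhs (almost_everywhere mu)) by exact: (ae_filter_ringOfSetsType mu).
(* The extra unit makes every [x <= b] interior, so that the two-sided derivative at [x = b] is
   covered as well. *)
pose D : set R := `[a, b + 1]%classic.
have ab1 : a <= b + 1 by rewrite (le_trans ab)// lerDl.
have [ihD _] := Hh _ ab1.
have ihr : mu.-integrable setT (EFin \o (h \_ D)).
  by move: ihD; rewrite integrable_mkcond//= (restrict_EFin h).
have iy y : mu.-integrable [set` Interval (BLeft a) (BRight y)] (EFin \o (h \_ D)).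
  by apply: integrableS ihr.
have FT := FTC1 iy (integrable_locally (measurable_itv _) ihD).
have hg : {ae mu, forall x, `]a, b]%classic x -> h x = g x}.
  apply: filterS2 df FT => x dfx FTx.
  rewrite /= in_itv/= => /andP[ax xb].
  have [dF F'] := FTx ax.
  have nE : \forall y \near x, f a + \int[mu]_(s in `[a, y]) (h \_ D) s = f y.
    near=> y.
    have ay : a <= y by apply: ltW; near: y; exact: lt_nbhsr.
    have yb : y <= b + 1.
      by apply: ltW; near: y; apply: lt_nbhsl; rewrite (le_lt_trans xb)// ltrDl.
    have [_ ->] := Hh y ay; congr (_ + _); apply: eq_Rintegral => s.
    rewrite inE/= in_itv/= => /andP[as_ sy]; rewrite patchE mem_set//.
    by rewrite /D/= in_itv/= as_ (le_trans sy).
  have dG : is_derive x (1 : R) (fun y => \int[mu]_(s in `[a, y]) (h \_ D) s) (h x).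
    apply: DeriveDef; first exact: dF.
    rewrite -derive1E F' patchE mem_set//.
    by rewrite /D/= in_itv/= (ltW ax) (le_trans xb)// lerDl.
  have [_ <-] := dfx (ltW ax).
  have [_ ->] := near_eq_is_derive nE (is_deriveD (is_derive_cst (f a) x 1) dG).
  by rewrite add0r.
have hg' : ae_eq mu `[a, b]%classic (EFin \o h) (EFin \o g).
  have na : mu.-negligible [set a].
    by apply/negligibleP => //; exact: lebesgue_measure_set1.
  have : {ae mu, forall x, x != a}.
    apply: negligibleS na => x /= /negP; rewrite negbK => /eqP ->//.
  apply: filterS2 hg => x H xa; rewrite /= in_itv/= => /andP[ax xb].
  by rewrite H//= in_itv/= xb andbT lt_neqAle eq_sym xa.
have [ih fb] := Hh _ ab.
have mgE : measurable_fun `[a, b] (EFin \o g) by apply/measurable_EFinP; exact: mg.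
have mhE : measurable_fun `[a, b] (EFin \o h) by case/integrableP : ih.
split.
  apply/integrableP; split => //; case/integrableP : ih => _; congr (_ < _)%E.
  apply: ae_eq_integral => //; [exact: measurableT_comp..|].
  by apply: filterS hg' => x H /H [hgx]; rewrite /= hgx.
rewrite fb; congr (_ + _); congr fine.
by apply: ae_eq_integral.
Unshelve. all: by end_near. Qed.

Lemma is_derive_Rintegral (f : R -> R) a t : a < t ->
  mu.-integrable `[a, t + 1] (EFin \o f) -> {for t, continuous f} ->
  is_derive t (1 : R) (fun s => \int[mu]_(x in `[a, s]) f x) (f t).
Proof.
move=> at_ fi cf; have t1 : t < t + 1 by rewrite ltrDl.
have [dF EF] := continuous_FTC1_closed t1 fi at_ cf.
by apply: DeriveDef; [exact: dF|rewrite -derive1E; exact: EF].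
Qed.

(** The derivative of [h] has the sign of [y - (c + L * G)], which the hypothesis makes nonpositive;
    [h] is compared at [a] and at the final time. *)
Lemma gronwall (y : R -> R) a c L : continuous y -> 0 <= L ->
  (forall t, a <= t -> y t <= c + L * \int[mu]_(s in `[a, t]) y s) ->
  forall t, a <= t -> y t <= c * expR (L * (t - a)).
Proof.
move=> cy L0 H T aT.
pose G t := \int[mu]_(s in `[a, t]) y s.
pose h t := (c + L * G t) * expR (- L * (t - a)).
suff hT : h T <= h a.
  have e0 : 0 < expR (L * (T - a)) by exact: expR_gt0.
  have Ga : G a = 0 by rewrite /G set_itv1 Rintegral_set1.
  move: hT; rewrite /h Ga mulr0 addr0 subrr mulr0 expR0 mulr1 mulNr expRN.
  by rewrite ler_pdivrMr//; apply: le_trans; exact: H.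
move: aT; rewrite le_eqVlt => /predU1P[<-//|aT].
have dG t : a < t -> is_derive t (1 : R) G (y t).
  by move=> at_; exact: (is_derive_Rintegral at_ (continuous_integrable_itv a (t + 1) cy) (cy t)).
have dh t : a < t -> is_derive t (1 : R) h (L * (y t - (c + L * G t)) * expR (- L * (t - a))).
  move=> at_.
  have dGt := dG t at_.
  apply: is_derive_eq.
  rewrite /GRing.scale/=; ring.
have cG : {within `[a, T], continuous G}.
  by apply: parameterized_integral_continuous (ltW aT) (continuous_integrable_itv a T cy).
apply: (@ler0_derive1_nincr _ h a T) => //.
- by move=> x; rewrite in_itv/= => /andP[ax _]; have [] := dh x ax.
- move=> x; rewrite in_itv/= => /andP[ax _]; have [_] := dh x ax.
  rewrite derive1E => ->; rewrite mulr_le0_ge0 ?expR_ge0// mulr_ge0_le0// subr_le0.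
  exact/H/ltW.
- move=> x; apply: cvgM; first by apply: cvgD; [exact: cvg_cst|apply: cvgMr; exact: cG].
  apply: (@continuous_subspaceT _ _ _ (fun t => expR (- L * (t - a)))) => {}x.
  apply: continuous_comp; last exact: continuous_expR.
  by apply: cvgMr; apply: cvgB => //; exact: cvg_cst.
- exact: ltW.
Qed.

(** A maximum of [f] on [[a, T]] that lies after [t1] and is positive would be a record; its left
    difference quotients are nonnegative, against the negative derivative. The derivative has to be
    controlled at records only, which is what makes the principle fit equations with delay. *)
Lemma bounded_of_decreasing_at_records f a t1 M : continuous f -> a <= t1 ->
  (forall t, a <= t -> t <= t1 -> f t <= M) -> 0 <= M ->
  (forall t, t1 < t -> 0 < f t -> (forall s, a <= s -> s <= t -> f s <= f t) ->
    exists2 d, d < 0 & is_derive t (1 : R) f d) ->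
  forall t, a <= t -> f t <= M.
Proof.
move=> cf at1 fM M0 H T aT.
have [s sab fs] := EVT_max aT (continuous_subspaceT cf).
have fTs : f T <= f s by apply: fs; rewrite in_itv/= aT lexx.
apply: le_trans fTs _.
move: sab; rewrite in_itv/= => /andP[as_ sT].
have [st1|t1s] := leP s t1; first exact: fM.
have [fs0|fs0] := leP (f s) 0; first exact: le_trans M0.
have [|d d0 ds] := H s t1s fs0.
  by move=> u au us; apply: fs; rewrite in_itv/= au (le_trans us).
exfalso; suff : 0 <= d by lra.
have [dv <-] := ds.
(* The maximum may sit at [T], where only the left difference quotients compare values inside
   [[a, T]]. *)
have dv' : cvg ((fun u : R => u^-1 *: ((f \o shift s) (u *: (1 : R)) - f s)) @ 0^') by exact: dv.
rewrite /derive (@cvg_at_leftE _ _ _ _ dv'); apply: limr_ge.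
  by apply: cvgP; apply: cvg_dnbhs_at_left; exact: dv'.
near=> u.
have u0 : u < 0 by near: u; exact: nbhs_left_lt.
rewrite /GRing.scale/= mulr1; apply: mulr_le0; first by rewrite invr_le0 ltW.
rewrite subr_le0 fs// in_itv/=; apply/andP; split; last by rewrite (le_trans _ sT)// gerDr ltW.
rewrite -lerBlDr; near: u; apply: nbhs_left_ge.
by rewrite subr_lt0 (le_lt_trans at1).
Unshelve. all: by end_near. Qed.

Lemma integrable_congr (D : set R) (f g : R -> R) : measurable D ->
  (forall x, D x -> f x = g x) ->
  mu.-integrable D (EFin \o f) -> mu.-integrable D (EFin \o g).
Proof.
move=> mD fg; apply: eq_integrable => // x /set_mem Dx.
by rewrite /= fg.
Qed.

Lemma integrable_addr (D : set R) (f g : R -> R) : measurable D ->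
  mu.-integrable D (EFin \o f) -> mu.-integrable D (EFin \o g) ->
  mu.-integrable D (EFin \o (fun s => f s + g s)).
Proof.
move=> mD fi gi.
have : mu.-integrable D ((EFin \o f) \+ (EFin \o g)) by exact: integrableD.
by apply: eq_integrable.
Qed.

Lemma integrable_scaler (D : set R) k (f : R -> R) : measurable D ->
  mu.-integrable D (EFin \o f) -> mu.-integrable D (EFin \o (fun s => k * f s)).
Proof.
move=> mD fi.
have : mu.-integrable D (fun x => k%:E * (EFin \o f) x)%E by exact: integrableZl.
by apply: eq_integrable.
Qed.

Lemma integrable_itv_cat (f : R -> R) a b c : a <= b -> b <= c ->
  mu.-integrable `[a, b] (EFin \o f) -> mu.-integrable `[b, c] (EFin \o f) ->
  mu.-integrable `[a, c] (EFin \o f).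
Proof.
move=> ab bc /integrableP[mf1 if1] /integrableP[mf2 if2].
have E : `[a, c]%classic = `[a, b]%classic `|` `]b, c]%classic.
  by apply: itv_bndbnd_setU; rewrite bnd_simp.
have sub : `]b, c]%classic `<=` `[b, c]%classic.
  by move=> x /=; rewrite !in_itv/= => /andP[/ltW-> ->].
have mf2' : measurable_fun `]b, c]%classic (EFin \o f) by exact: measurable_funS mf2.
rewrite E; apply/integrableP; split; first by apply/measurable_funU.
rewrite ge0_integral_setU//.
- apply: lte_add_pinfty => //; apply: le_lt_trans if2.
  by apply: ge0_subset_integral => //; exact: measurableT_comp.
- by apply/measurable_funU => //; split; exact: measurableT_comp.
- apply/disj_setPS => y [/=]; rewrite 2!in_itv/= => /andP[_ yx] /andP[].
  by rewrite ltNge yx.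
Qed.

Lemma Rintegral_le_itv (f : R -> R) a b (M : R) : a <= b ->
  mu.-integrable `[a, b] (EFin \o f) -> (forall x, a <= x -> x <= b -> f x <= M) ->
  \int[mu]_(x in `[a, b]) f x <= M * (b - a).
Proof.
move=> ab fi fM.
have : \int[mu]_(x in `[a, b]) f x <= \int[mu]_(x in `[a, b]) (cst M x).
  apply: le_Rintegral => //.
    by apply: continuous_integrable_itv; exact: cst_continuous.
  by move=> x /=; rewrite in_itv/= => /andP[ax xb]; exact: fM.
rewrite Rintegral_cst//= lebesgue_measure_itv/= lte_fin.
case: ltgtP ab => // -> _.
by rewrite subrr.
Qed.

(** On a bounded interval [|f| <= 1 + f^2] is an integrable bound. *)
Lemma square_integrable_integrable (f : R -> R) a b : square_integrable `[a, b] f ->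
  mu.-integrable `[a, b] (EFin \o f).
Proof.
move=> [mf if2].
apply: (@le_integrable _ _ _ mu _ _ _ (EFin \o (fun s => 1 + f s ^+ 2))) => //.
- by apply/measurable_EFinP.
- move=> x _ /=; rewrite lee_fin.
  have h : 0 <= (`|f x| - 1) ^+ 2 by rewrite sqr_ge0.
  have e : `|f x| ^+ 2 = f x ^+ 2 by rewrite real_normK ?num_real.
  rewrite [leRHS]ger0_norm ?addr_ge0 ?sqr_ge0//.
  have := normr_ge0 (f x); nra.
- have : mu.-integrable `[a, b] ((EFin \o cst 1) \+ (EFin \o (fun s => f s ^+ 2))).
    apply: integrableD => //.
    by apply: continuous_integrable_itv; exact: cst_continuous.
  by apply: eq_integrable.
Qed.

Lemma Rintegral_norm_sqr_le (f : R -> R) a b : a <= b -> square_integrable `[a, b] f ->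
  (\int[mu]_(s in `[a, b]) `|f s|) ^+ 2 <= (b - a) * \int[mu]_(s in `[a, b]) (f s ^+ 2).
Proof.
move=> ab fL; have [mf if2] := fL.
have if1 := square_integrable_integrable fL.
have in1 : mu.-integrable `[a, b] (EFin \o (fun s => `|f s|)).
  by have := integrable_abse if1.
move: ab; rewrite le_eqVlt => /predU1P[->|ab].
  by rewrite set_itv1 !Rintegral_set1 subrr mul0r expr0n.
have ba : 0 < b - a by rewrite subr_gt0.
set h := \int[mu]_(s in _) `|f s|; set h2 := \int[mu]_(s in _) _ ^+ 2.
(* Integrate (|f| - m)^2 >= 0 with m the mean value of |f|. *)
pose m := h / (b - a).
have : 0 <= \int[mu]_(s in `[a, b]) ((f s ^+ 2 + m ^+ 2) - (2 * m) * `|f s|).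
  apply: Rintegral_ge0 => x _.
  have e : `|f x| ^+ 2 = f x ^+ 2 by rewrite real_normK ?num_real.
  have : 0 <= (`|f x| - m) ^+ 2 by rewrite sqr_ge0.
  rewrite sqrrB e; lra.
have ic : mu.-integrable `[a, b] (EFin \o (fun=> m ^+ 2)).
  by apply: continuous_integrable_itv; exact: cst_continuous.
have id : mu.-integrable `[a, b] (EFin \o (fun s => f s ^+ 2 + m ^+ 2)).
  exact: integrable_addr.
have im : mu.-integrable `[a, b] (EFin \o (fun s => (2 * m) * `|f s|)).
  exact: integrable_scaler.
have Ec : \int[mu]_(s in `[a, b]) (m ^+ 2) = m ^+ 2 * (b - a).
  by rewrite Rintegral_cst//= lebesgue_measure_itv/= lte_fin ab.
have -> : \int[mu]_(s in `[a, b]) ((f s ^+ 2 + m ^+ 2) - (2 * m) * `|f s|) =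
    h2 + m ^+ 2 * (b - a) - 2 * m * h.
  by rewrite RintegralB// RintegralD// Ec RintegralZl//.
have hm : h = m * (b - a) by rewrite /m divfK// gt_eqF.
rewrite hm => H.
have : 0 <= h2 - m ^+ 2 * (b - a) by move: H; rewrite -subr_ge0; nra.
by move=> H2; have := mulr_ge0 (ltW ba) H2; rewrite -subr_ge0; lra.
Qed.

(** Integrability of the composite is part of the conclusion: for the delayed input it is not known
    beforehand. *)
Lemma Rintegral_expanding (phi : R -> R) k (D S : set R) (f : R -> R) : 0 < k ->
  (forall s t, s <= t -> t - s <= k * (phi t - phi s)) ->
  measurable_fun setT phi -> measurable D -> measurable S -> S `<=` phi @^-1` D ->
  mu.-integrable D (EFin \o f) -> (forall y, D y -> 0 <= f y) ->
  mu.-integrable S (EFin \o (f \o phi)) /\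
  \int[mu]_(x in S) f (phi x) <= k * \int[mu]_(y in D) f y.
Proof.
move=> k0 kphi mphi mD mS SD fi f0.
have mf : measurable_fun D f by apply/measurable_EFinP; case/integrableP : fi.
have mfphi : measurable_fun S (f \o phi).
  apply: (@measurable_comp _ _ _ _ _ _ D) => //.
    by move=> _ [x Sx <-]; exact: SD.
  exact: measurable_funS mphi.
have mpre : measurable (phi @^-1` D).
  by rewrite -[X in measurable X]setTI; exact: mphi.
have H := ge0_integral_expanding k0 kphi mphi mD mf f0.
have mfpre : measurable_fun (phi @^-1` D) (f \o phi).
  apply: (@measurable_comp _ _ _ _ _ _ D) => //.
    by move=> _ [x Sx <-].
  exact: measurable_funS mphi.
have S0 x : S x -> 0 <= f (phi x) by move=> /SD; exact: f0.
have intS_le : (\int[mu]_(x in S) (f (phi x))%:E <= k%:E * \int[mu]_(y in D) (f y)%:E)%E.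
  apply: le_trans H; apply: ge0_subset_integral => //.
  - by apply/measurable_EFinP.
  - by move=> x Dx; rewrite lee_fin f0.
have Dfin : (\int[mu]_(y in D) (f y)%:E)%E \is a fin_num by exact: integrable_fin_num.
have fin : (k%:E * \int[mu]_(y in D) (f y)%:E < +oo)%E.
  by rewrite -(fineK Dfin) -EFinM ltry.
have Si : mu.-integrable S (EFin \o (f \o phi)).
  apply/integrableP; split; first by apply/measurable_EFinP.
  rewrite (eq_integral (fun x : measurableTypeR R => (f (phi x))%:E)); first exact: le_lt_trans intS_le fin.
  by move=> x /set_mem Sx; rewrite /= ger0_norm// S0.
split => //.
rewrite -lee_fin EFinM /Rintegral !fineK//.
exact: integrable_fin_num.
Qed.

Lemma Rintegral_sum (I : Type) (r : seq I) (D : set R) (f : I -> R -> R) : measurable D ->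
  (forall i, mu.-integrable D (EFin \o f i)) ->
  mu.-integrable D (EFin \o (fun x => \sum_(i <- r) f i x)) /\
  \int[mu]_(x in D) (\sum_(i <- r) f i x) = \sum_(i <- r) \int[mu]_(x in D) f i x.
Proof.
move=> mD fi; elim: r => [|i r [IH1 IH2]].
  have -> : (fun x : R => \sum_(i <- [::]) f i x) = cst 0.
    by apply/funext => x; rewrite big_nil.
  split; first exact: integrable0.
  by rewrite big_nil Rintegral_cst// mul0r.
have E : (fun x : R => \sum_(j <- i :: r) f j x) = (fun x => f i x + \sum_(j <- r) f j x).
  by apply/funext => x; rewrite big_cons.
rewrite E; split; first exact: integrable_addr.
by rewrite RintegralD// IH2 big_cons.
Qed.

(** At interior points the relative derivative is an ordinary one, and at [a] continuity from the
    right is enough for the mean value theorem. *)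
Lemma C1_on_lipschitz (f f' : R -> R) a k : C1_on `[a, +oo[ f f' ->
  (forall t, a <= t -> `|f' t| <= k) ->
  forall s t, a <= s -> s <= t -> `|f t - f s| <= k * (t - s).
Proof.
move=> [df _] f'k s t as_ st.
have D x : a <= x -> `[a, +oo[%classic x by rewrite /= in_itv/= andbT.
have dfx x : a < x -> is_derive x (1 : R) f (f' x).
  move=> ax.
  have cv : (fun h : R => h^-1 *: ((f \o shift x) (h *: (1 : R)) - f x)) @ 0^' --> f' x.
    have sh : (fun h : R => h + x) @ 0^' --> within `[a, +oo[%classic (x^').
      move=> P; rewrite /within /dnbhs /= => nP.
      have c0 : (fun h : R => h + x) @ (0 : R) --> x.
        by rewrite -[X in _ --> X]add0r; apply: cvgD => //; exact: cvg_cst.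
      have a0 : \forall h \near (0 : R), a < h + x.
        by have := c0 _ (lt_nbhsr ax).
      have n1 := c0 _ nP.
      suff : \forall h \near (0 : R), h != 0 -> P (h + x) by [].
      near=> h => h0.
      have H : h + x != x -> `[a, +oo[%classic (h + x) -> P (h + x).
        by near: h; exact: n1.
      apply: H; first by rewrite -subr_eq0 addrK.
      by apply/D/ltW; near: h; exact: a0.
    have := @cvg_comp _ _ _ (fun h : R => h + x) (fun s => (f s - f x) / (s - x))
      _ _ _ sh (df x (D _ (ltW ax))).
    apply: cvg_trans; apply: near_eq_cvg; near=> h.
    by rewrite /= /GRing.scale/= mulr1 addrK mulrC.
  apply: DeriveDef; first by apply: cvgP cv.
  exact: cvg_lim cv.
(* Near [x] the difference quotients are bounded by [|f' x| + 1], which gives continuity, also at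
   the end point [a]. *)
have cf x : a <= x -> f @ within `[a, +oo[ (nbhs x) --> f x.
  move=> ax; have H := df x (D _ ax); rewrite /has_derivative_on in H.
  apply/cvgrPdist_lt => e e0.
  have l1 : 0 < `|f' x| + 1 by rewrite ltr_wpDl.
  have H1 : \forall y \near x, y != x -> `[a, +oo[%classic y ->
      `|f' x - (f y - f x) / (y - x)| < 1 := (cvgrPdist_lt _ _).1 H 1 ltr01.
  suff : \forall y \near x, `[a, +oo[%classic y -> `|f x - f y| < e by [].
  near=> y => Dy.
  have [->|yx] := eqVneq y x; first by rewrite subrr normr0.
  have H2 : `|f' x - (f y - f x) / (y - x)| < 1.
    have : y != x -> `[a, +oo[%classic y -> `|f' x - (f y - f x) / (y - x)| < 1.
      by near: y; exact: H1.
    exact.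
  have yx0 : y - x != 0 by rewrite subr_eq0.
  have Q : `|(f y - f x) / (y - x)| <= `|f' x| + 1.
    have := ler_normB (f' x) (f' x - (f y - f x) / (y - x)).
    rewrite opprB addrC subrK => /le_trans; apply.
    by rewrite lerD2l ltW.
  have -> : f x - f y = - ((f y - f x) / (y - x)) * (y - x) by rewrite mulNr divfK// opprB.
  rewrite normrM normrN; apply: (@le_lt_trans _ _ ((`|f' x| + 1) * `|y - x|)).
    by rewrite ler_wpM2r.
  rewrite mulrC -ltr_pdivlMr// distrC; near: y.
  by apply: cvgr_dist_lt; rewrite ?divr_gt0.
have cf' : {within `[s, t], continuous f}.
  apply: (@continuous_subspaceW _ _ _ `[a, +oo[%classic).
    by move=> x /=; rewrite !in_itv/= andbT => /andP[sx _]; exact: le_trans as_ sx.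
  by apply/subspace_continuousP => x; rewrite /= in_itv/= andbT; exact: cf.
have dst x : x \in `]s, t[ -> is_derive x 1 f (f' x).
  by rewrite in_itv/= => /andP[sx _]; apply: dfx; exact: le_lt_trans sx.
have [c] := MVT_segment st dst cf'.
rewrite in_itv/= => /andP[sc _] ->.
rewrite normrM (ger0_norm (_ : 0 <= t - s)) ?subr_ge0// ler_wpM2r ?subr_ge0//.
exact/f'k/(le_trans as_).
Unshelve. all: by end_near. Qed.

End RealAnalysis.

(** * Norms of matrices *)

Section Norm.
Variable R : realType.
Notation mu := (@lebesgue_measure R).

(** The sum norm is submultiplicative for all shapes, and passes under integrals entry by entry; the
    Euclidean norm enters only through [dotv]. *)
Definition nrm m p (M : 'M[R]_(m, p)) : R := \sum_i \sum_j `|M i j|.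

Lemma nrm_ge0 m p (M : 'M[R]_(m, p)) : 0 <= nrm M.
Proof. by apply: sumr_ge0 => i _; apply: sumr_ge0. Qed.

Lemma ler_nrmD m p (M N : 'M[R]_(m, p)) : nrm (M + N) <= nrm M + nrm N.
Proof.
rewrite /nrm -big_split /=; apply: ler_sum => i _.
by rewrite -big_split /=; apply: ler_sum => j _; rewrite mxE ler_normD.
Qed.

Lemma nrmN m p (M : 'M[R]_(m, p)) : nrm (- M) = nrm M.
Proof. by apply: eq_bigr => i _; apply: eq_bigr => j _; rewrite mxE normrN. Qed.

Lemma nrmZ m p a (M : 'M[R]_(m, p)) : nrm (a *: M) = `|a| * nrm M.
Proof.
rewrite /nrm mulr_sumr; apply: eq_bigr => i _; rewrite mulr_sumr.
by apply: eq_bigr => j _; rewrite mxE normrM.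
Qed.

Lemma ler_nrmM m p q (M : 'M[R]_(m, p)) (N : 'M[R]_(p, q)) : nrm (M *m N) <= nrm M * nrm N.
Proof.
apply: (@le_trans _ _ (\sum_i \sum_j \sum_k `|M i k| * `|N k j|)).
  apply: ler_sum => i _; apply: ler_sum => j _.
  by rewrite mxE (le_trans (ler_norm_sum _ _ _))//; apply: ler_sum => k _; rewrite normrM.
rewrite /nrm mulr_suml; apply: ler_sum => i _.
rewrite exchange_big mulr_suml; apply: ler_sum => k _ /=.
rewrite -mulr_sumr ler_wpM2l// (bigD1 k)//= lerDl.
by apply: sumr_ge0 => l _; apply: sumr_ge0.
Qed.

Lemma entry_le_nrm m p (M : 'M[R]_(m, p)) i j : `|M i j| <= nrm M.
Proof.
rewrite /nrm (bigD1 i)//= (bigD1 j)//= -addrA lerDl addr_ge0 ?sumr_ge0//.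
by move=> k _; apply: sumr_ge0.
Qed.

Lemma nrm_col m (x : 'cV[R]_m) : nrm x = \sum_i `|x i 0|.
Proof. by apply: eq_bigr => i _; rewrite big_ord1. Qed.

Lemma dotv_le_nrm m (x y : 'cV[R]_m) : dotv x y <= nrm x * nrm y.
Proof.
rewrite nrm_col /dotv mulr_suml; apply: ler_sum => i _.
by rewrite (le_trans (ler_norm _))// normrM ler_wpM2l// entry_le_nrm.
Qed.

Lemma dotv_enorm m (x : 'cV[R]_m) : enorm x ^+ 2 = dotv x x.
Proof.
rewrite /enorm sqr_sqrtr; last by apply: sumr_ge0 => i _; rewrite sqr_ge0.
by apply: eq_bigr => i _; rewrite expr2.
Qed.

Lemma sqr_nrm_le m (x : 'cV[R]_m) : nrm x ^+ 2 <= m%:R * dotv x x.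
Proof.
rewrite nrm_col expr2 mulr_suml.
apply: (@le_trans _ _ (\sum_i \sum_j (`|x i 0| ^+ 2 / 2 + `|x j 0| ^+ 2 / 2))).
  apply: ler_sum => i _; rewrite mulr_sumr; apply: ler_sum => j _.
  have : 0 <= (`|x i 0| - `|x j 0|) ^+ 2 by rewrite sqr_ge0.
  rewrite sqrrB; lra.
have S : \sum_i `|x i 0| ^+ 2 = dotv x x.
  by apply: eq_bigr => i _; rewrite real_normK ?num_real// expr2.
rewrite (eq_bigr (fun i => m%:R * (`|x i 0| ^+ 2 / 2) + dotv x x / 2)); last first.
  by move=> i _; rewrite big_split /= sumr_const card_ord mulr_natl -mulr_suml S.
rewrite big_split /= -mulr_sumr -mulr_suml S sumr_const card_ord -mulr_natl; lra.
Qed.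

Lemma mderiv_continuous m p (F dF : R -> 'M[R]_(m, p)) t i j : mderiv F t (dF t) ->
  {for t, continuous (fun s => F s i j)}.
Proof.
move=> H; have [d _] := H i j.
by apply/differentiable_continuous/derivable1_diffP.
Qed.

Lemma mderiv_of_is_derive m p (F : R -> 'M[R]_(m, p)) t dF :
  is_derive t (1 : R) F dF -> mderiv F t dF.
Proof.
move=> [dv <-] i j; apply: DeriveDef; first by move/derivable_mxP : dv; exact.
by rewrite derive_mx// mxE.
Qed.

Lemma nrm_integral_cv_le m (D : set R) (f : R -> 'cV[R]_m) (g : R -> R) : measurable D ->
  (forall i, mu.-integrable D (EFin \o (fun s => f s i 0))) ->
  mu.-integrable D (EFin \o g) -> (forall s, D s -> nrm (f s) <= g s) ->
  nrm (integral_cv D f) <= \int[mu]_(s in D) g s.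
Proof.
move=> mD fi gi fg.
have fi' i : mu.-integrable D (EFin \o (fun s => `|f s i 0|)).
  by have := integrable_abse (fi i).
have [Si SE] := Rintegral_sum (index_enum 'I_m) mD fi'.
apply: (@le_trans _ _ (\int[mu]_(s in D) (\sum_i `|f s i 0|))).
  rewrite SE nrm_col; apply: ler_sum => i _.
  by rewrite mxE le_normr_Rintegral.
by apply: le_Rintegral => // s Ds; rewrite -nrm_col fg.
Qed.

Lemma continuous_mulmx m p q (M : R -> 'M[R]_(m, p)) (N : R -> 'M[R]_(p, q)) :
  (forall i j, continuous (fun s => M s i j)) ->
  (forall i j, continuous (fun s => N s i j)) ->
  forall i j, continuous (fun s => (M s *m N s) i j).
Proof.
move=> cM cN i j s.
rewrite (_ : (fun s => _) = fun s => \sum_k M s i k * N s k j).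
  by apply: (@cvg_sum_fun R) => k; apply: cvgM; [exact: cM|exact: cN].
by apply/funext => x; rewrite mxE.
Qed.

Lemma continuous_nrm m p (M : R -> 'M[R]_(m, p)) :
  (forall i j, continuous (fun s => M s i j)) -> continuous (fun s => nrm (M s)).
Proof.
move=> cM s; apply: cvg_sum_fun => i; apply: cvg_sum_fun => j.
by apply: cvg_norm; exact: cM.
Qed.

Lemma expmx_continuous n (A : 'M[R]_n) i j : continuous (fun s : R => expmx (s *: A) i j).
Proof.
move=> s.
exact: (mderiv_continuous (dF := fun s => A *m expmx (s *: A)) (mderiv_expmx A s)).
Qed.

Lemma expmx_bounded n (A : 'M[R]_n) a : exists2 e, 0 < e &
  forall t, `|t| <= a -> nrm (expmx (t *: A)) <= e.
Proof.
have [a0|a0] := leP 0 a; last first.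
  by exists 1 => // t ta; have := le_lt_trans ta a0; rewrite normr_lt0.
have cE := continuous_nrm (M := fun s : R => expmx (s *: A)) (@expmx_continuous n A).
have aa : - a <= a by rewrite ge0_cp.
have [c _ Hc] := EVT_max aa (continuous_subspaceT cE).
exists (nrm (expmx (c *: A)) + 1); first by rewrite ltr_wpDl// nrm_ge0.
move=> t; rewrite ler_norml => ta; rewrite (le_trans (Hc t _))//.
by rewrite lerDl.
Qed.

End Norm.

(** * Solutions of the closed loop *)

Section Solution.
Variables (R : realType) (n : nat) (A : 'M[R]_n) (B : 'cV[R]_n) (K : 'rV[R]_n).
Variables (Dh t0 d1 : R) (dl : R -> R) (X : R -> 'cV[R]_n) (U : R -> R).
Notation mu := (@lebesgue_measure R).

Definition delayed t := t - Dh - dl t.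
(** The lower limit of the first integral of [Pi_L] at [t0]: the beginning of the recorded input. *)
Definition history_start := t0 - Dh - Num.max 0 (dl t0).
Notation phi := delayed.
Notation h0 := history_start.
Notation E t := (expmx (t *: A)).

Definition predictor_integral t :=
  integral_cv `[t - Dh, t] (fun s => U s *: (E (t - s) *m B)).
Definition predictor t := E Dh *m X t + predictor_integral t.
Notation I := predictor_integral.
Notation Z := predictor.

(** The bounds on [dl] hold on the whole line, since it stands for the perturbation frozen before
    [t0]. Slope [1/2] makes [phi] expanding with constant 2, and [d1 <= Dh / 2] keeps [phi t]
    between [t - 3/2 * Dh] and [t - Dh / 2]. *)
Hypotheses (Dh0 : 0 < Dh) (d1Dh : d1 <= Dh / 2).
Hypothesis dl_le : forall t, `|dl t| <= d1.
Hypothesis dl_lip : forall s t, s <= t -> `|dl t - dl s| <= (t - s) / 2.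
Hypothesis X_ac : forall i, loc_abs_continuous t0 (fun t => X t i 0).
Hypothesis U_ac : loc_abs_continuous (t0 - Dh) U.
Hypothesis U_L2 : square_integrable `[h0, t0] U.
Hypothesis X_eq : {ae mu, forall t, t0 <= t ->
  mderiv X t (A *m X t + U (phi t) *: B)}.
Hypothesis U_eq : forall t, t0 <= t -> U t = (K *m Z t) 0 0.

(** * The delayed time and the regularity of the input *)

Lemma delayed_expanding s t : s <= t -> t - s <= 2 * (phi t - phi s).
Proof. by move=> st; have := dl_lip st; rewrite ler_norml /delayed; lra. Qed.

Lemma delayed_continuous : continuous phi.
Proof.
move=> t; apply: cvgB; first by apply: cvgB => //; exact: cvg_cst.
apply/cvgrPdist_lt => e e0; near=> s.
have ts : `|t - s| < e by near: s; exact: cvgr_dist_lt.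
have [st|/ltW ts'] := leP s t.
  apply: le_lt_trans (dl_lip st) _; move: ts; rewrite ger0_norm ?subr_ge0//; lra.
rewrite distrC; apply: le_lt_trans (dl_lip ts') _.
by move: ts; rewrite distrC ger0_norm ?subr_ge0//; lra.
Unshelve. all: by end_near. Qed.

Lemma measurable_delayed : measurable_fun setT phi.
Proof. exact: continuous_measurable_fun delayed_continuous. Qed.

Lemma history_start_le : h0 <= t0 - Dh.
Proof. by rewrite /history_start gerBl le_max lexx. Qed.

Lemma history_start_ge : t0 - Dh - d1 <= h0.
Proof.
rewrite /history_start lerD2l lerN2 ge_max.
have := dl_le t0; have := normr_ge0 (dl t0); rewrite ler_norml.
by move=> n0 /andP[_ ->]; rewrite (le_trans n0).
Qed.

(** [phi] increases, so [phi t >= phi t0], and [phi t0] lies in the recorded past whatever the sign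
    of [dl t0]. *)
Lemma history_start_le_delayed t : t0 <= t -> h0 <= phi t.
Proof.
move=> t0t; have := delayed_expanding t0t; rewrite /delayed /history_start.
have : dl t0 <= Num.max 0 (dl t0) by rewrite le_max lexx orbT.
lra.
Qed.

Lemma delayed_le t : phi t <= t - Dh / 2.
Proof. by have := dl_le t; rewrite ler_norml /delayed => /andP[]; move: d1Dh; lra. Qed.

Lemma delayed_ge t : t - Dh * (3 / 2) <= phi t.
Proof. by have := dl_le t; rewrite ler_norml /delayed => /andP[]; move: d1Dh; lra. Qed.

Lemma input_within_continuous : {within `[t0 - Dh, +oo[, continuous U}.
Proof. exact: ac_within_continuous. Qed.

Lemma input_continuous_at t : t0 - Dh < t -> {for t, continuous U}.
Proof.
have [+ _] := (continuous_within_itvcyP _ _).1 input_within_continuous.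
by move=> H tt; apply: H; rewrite in_itv/= andbT.
Qed.

Lemma clamp_input_continuous : continuous (fun t => U (Num.max (t0 - Dh) t)).
Proof. exact/continuous_clamp/input_within_continuous. Qed.

Lemma clamp_input_continuous0 : continuous (fun t => U (Num.max t0 t)).
Proof.
apply: continuous_clamp; apply: continuous_subspaceW input_within_continuous.
by move=> x /=; rewrite !in_itv/= !andbT => /(le_trans _); apply; rewrite gerBl ltW.
Qed.

Lemma clamp_state_continuous i j : continuous (fun t => X (Num.max t0 t) i j).
Proof.
rewrite (ord1 j).
exact: (@continuous_clamp _ t0 (fun t => X t i 0) (ac_within_continuous (X_ac i))).
Qed.

(** Up to [t0] this is the assumption on the history, and after [t0] the input is continuous. *)
Lemma input_square_integrable a b : h0 <= a -> square_integrable `[a, b] U.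
Proof.
move=> h0a; pose T := Num.max t0 b.
have t0T : t0 <= T by rewrite le_max lexx.
have h0t0 : h0 <= t0 by rewrite (le_trans history_start_le)// gerBl ltW.
have sub : `[a, b]%classic `<=` `[h0, T]%classic.
  move=> x /=; rewrite !in_itv/= => /andP[ax xb].
  by rewrite (le_trans h0a)//= le_max xb orbT.
have ev : {in `[t0, T]%classic, (fun t => U (Num.max t0 t)) =1 U}.
  by move=> x; rewrite inE/= in_itv/= => /andP[/max_r ->].
have iU : mu.-integrable `[t0, T] (EFin \o U).
  have := continuous_integrable_itv t0 T clamp_input_continuous0.
  by apply: eq_integrable => // x xD; rewrite /= ev.
have iU2 : mu.-integrable `[t0, T] (EFin \o (fun s => U s ^+ 2)).
  have cU2 : continuous (fun t => U (Num.max t0 t) ^+ 2).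
    by move=> t; apply: cvgM; exact: clamp_input_continuous0.
  have := continuous_integrable_itv t0 T cU2.
  by apply: eq_integrable => // x xD; rewrite /= ev.
have J := integrable_itv_cat h0t0 t0T (square_integrable_integrable U_L2) iU.
have [_ L2] := U_L2.
have J2 := integrable_itv_cat h0t0 t0T L2 iU2.
split; last exact: integrableS J2.
by apply: measurable_funS sub _ => //; apply/measurable_EFinP; case/integrableP : J.
Qed.

Lemma input_norm_integrable a b : h0 <= a ->
  mu.-integrable `[a, b] (EFin \o (fun s => `|U s|)).
Proof.
move=> ha; have := integrable_abse (square_integrable_integrable (input_square_integrable b ha)).
by apply: eq_integrable.
Qed.

Lemma delayed_in a b t : t0 <= t -> a <= phi t -> t <= b -> h0 <= a ->
  `[a, b]%classic (phi t).
Proof.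
move=> t0t at_ tb ha; rewrite /= in_itv/= at_ /=.
by apply: le_trans (delayed_le t) _; rewrite (le_trans _ tb)// gerBl divr_ge0// ltW.
Qed.

Lemma measurable_delayed_input b : measurable_fun `[t0, b] (fun s => U (phi s)).
Proof.
have [mU _] := input_square_integrable b (lexx h0).
apply: (@measurable_comp _ _ _ _ _ _ `[h0, b]%classic) => //.
  move=> _ [x /= xab <-]; move: xab; rewrite in_itv/= => /andP[t0x xb].
  by apply: delayed_in => //; exact: history_start_le_delayed.
exact: measurable_funS measurable_delayed.
Qed.

Lemma delayed_input_norm_integrable t : t0 <= t ->
  mu.-integrable `[t0, t] (EFin \o (fun s => `|U (phi s)|)) /\
  \int[mu]_(s in `[t0, t]) `|U (phi s)| <= 2 * \int[mu]_(s in `[h0, t]) `|U s|.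
Proof.
move=> t0t.
apply: (@Rintegral_expanding _ phi 2 _ _ (fun s => `|U s|)) => //.
- exact: delayed_expanding.
- exact: measurable_delayed.
- move=> x /=; rewrite in_itv/= => /andP[t0x xt].
  by apply: delayed_in => //; exact: history_start_le_delayed.
- exact: input_norm_integrable.
Qed.

(** The plant equation holds only almost everywhere; its integrated form comes from [ac_integral],
    once the right-hand side is known to be measurable. *)
Lemma state_integral t : t0 <= t ->
  (forall i, mu.-integrable `[t0, t] (EFin \o (fun s => (A *m X s + U (phi s) *: B) i 0))) /\
  X t = X t0 + integral_cv `[t0, t] (fun s => A *m X s + U (phi s) *: B).
Proof.
move=> t0t.
have H i := @ac_integral R t0 (fun t => X t i 0) (fun s => (A *m X s + U (phi s) *: B) i 0)
  (X_ac i).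
have ae i : {ae mu, forall t, t0 <= t ->
    is_derive t (1 : R) (fun t => X t i 0) ((A *m X t + U (phi t) *: B) i 0)}.
  apply: filterS X_eq; first exact: (ae_filter_ringOfSetsType mu).
  by move=> x Hx t0x; exact: Hx.
have mg i b : t0 <= b -> measurable_fun `[t0, b] (fun s => (A *m X s + U (phi s) *: B) i 0).
  move=> t0b.
  have -> : (fun s => (A *m X s + U (phi s) *: B) i 0) =
      (fun s => (A *m X s) i 0 + U (phi s) * B i 0).
    by apply/funext => s; rewrite !mxE.
  apply: measurable_funD; last first.
    by apply: measurable_funM => //; exact: measurable_delayed_input.
  apply: (@eq_measurable_fun _ _ _ _ _ (fun s => (A *m X (Num.max t0 s)) i 0)).
    by move=> x; rewrite inE/= in_itv/= => /andP[/max_r ->].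
  apply: measurable_funS (@subsetT _ _) _ => //.
  apply: continuous_measurable_fun.
  apply: (@continuous_mulmx _ _ _ _ (fun=> A)); last exact: clamp_state_continuous.
  by move=> k j s; exact: cvg_cst.
split; first by move=> i; have [] := H i (ae i) (mg i) t t0t.
apply/matrixP => i j; rewrite (ord1 j) [RHS]mxE [X in _ + X]mxE.
by have [_] := H i (ae i) (mg i) t t0t.
Qed.

(** * Growth of solutions by Gronwall's inequality *)

Variable e : R.
Hypotheses (e0 : 0 < e) (E_le : forall t, `|t| <= Dh -> nrm (E t) <= e).

Definition past_input := \int[mu]_(s in `[h0, t0]) `|U s|.
Notation h := past_input.
Definition past := nrm (X t0) + h.

Lemma past_input_ge0 : 0 <= h.
Proof. by apply: Rintegral_ge0 => x _; exact: normr_ge0. Qed.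

Lemma past_ge0 : 0 <= past.
Proof. by rewrite addr_ge0 ?nrm_ge0// past_input_ge0. Qed.

Lemma input_integral_le t : t0 <= t ->
  \int[mu]_(s in `[t - Dh, t]) `|U s| <= h + \int[mu]_(s in `[t0, t]) `|U s|.
Proof.
move=> t0t; rewrite -Rintegral_itv_split//; last first.
- exact: input_norm_integrable.
- by rewrite (le_trans history_start_le)// gerBl ltW.
apply: Rintegral_le_subset => //.
- move=> x /=; rewrite !in_itv/= => /andP[xt ->]; rewrite andbT.
  by rewrite (le_trans history_start_le)// (le_trans _ xt)// lerB.
- exact: input_norm_integrable.
Qed.

Lemma predictor_integral_le t : t0 <= t ->
  nrm (I t) <= e * nrm B * \int[mu]_(s in `[t - Dh, t]) `|U s|.
Proof.
move=> t0t.
have h0t : h0 <= t - Dh by rewrite (le_trans history_start_le)// lerB.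
have Ui := input_norm_integrable t h0t.
rewrite -RintegralZl//.
apply: nrm_integral_cv_le => //.
- move=> i.
  pose f s := U (Num.max (t0 - Dh) s) * (E (t - s) *m B) i 0.
  have cf : continuous f.
    move=> s; apply: cvgM; first exact: clamp_input_continuous.
    apply: continuous_mulmx => [k j|k j] x; last exact: cvg_cst.
    exact: (mderiv_continuous (dF := fun s => - (A *m E (t - s))) (mderiv_expmx_opp A t x)).
  have := continuous_integrable_itv (t - Dh) t cf.
  apply: eq_integrable => // s; rewrite inE/= in_itv/= => /andP[ts _].
  by rewrite /f /= !mxE max_r// (le_trans _ ts)// lerB.
- exact: integrable_scaler.
- move=> s /=; rewrite in_itv/= => /andP[ts st].
  rewrite nrmZ mulrC ler_wpM2r//.
  apply: le_trans (ler_nrmM _ _) _; rewrite ler_wpM2r ?nrm_ge0//; apply: E_le.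
  by rewrite ger0_norm; lra.
Qed.

Lemma predictor_le t : t0 <= t ->
  nrm (Z t) <= e * nrm (X t) + e * nrm B * \int[mu]_(s in `[t - Dh, t]) `|U s|.
Proof.
move=> t0t; apply: le_trans (ler_nrmD _ _) _; apply: lerD (predictor_integral_le t0t).
apply: le_trans (ler_nrmM _ _) _; rewrite ler_wpM2r ?nrm_ge0//; apply: E_le.
by rewrite ger0_norm// ltW.
Qed.

Lemma input_le t : t0 <= t -> `|U t| <= nrm K * nrm (Z t).
Proof.
by move=> t0t; rewrite U_eq//; apply: le_trans (entry_le_nrm _ _ _) (ler_nrmM _ _).
Qed.

Lemma state_norm_integrable t : mu.-integrable `[t0, t] (EFin \o (fun s => nrm (X s))).
Proof.
have := continuous_integrable_itv t0 t (continuous_nrm clamp_state_continuous).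
by apply: eq_integrable => // x; rewrite inE/= in_itv/= => /andP[/max_r ->].
Qed.

Lemma state_le t : t0 <= t -> nrm (X t) <= nrm (X t0) +
  nrm A * \int[mu]_(s in `[t0, t]) nrm (X s) +
  2 * nrm B * (h + \int[mu]_(s in `[t0, t]) `|U s|).
Proof.
move=> t0t; have [Xi {1}->] := state_integral t0t.
apply: le_trans (ler_nrmD _ _) _; rewrite -addrA lerD2l.
have [Ui Ule] := delayed_input_norm_integrable t0t.
have aX := integrable_scaler (nrm A) (measurable_itv _) (state_norm_integrable t).
have bU := integrable_scaler (nrm B) (measurable_itv _) Ui.
apply: (@le_trans _ _ (\int[mu]_(s in `[t0, t]) (nrm A * nrm (X s) + nrm B * `|U (phi s)|))).
  apply: nrm_integral_cv_le => //; first exact: integrable_addr.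
  move=> s _; apply: le_trans (ler_nrmD _ _) _; apply: lerD; first exact: ler_nrmM.
  by rewrite nrmZ mulrC.
rewrite RintegralD// RintegralZl//; last exact: state_norm_integrable.
rewrite RintegralZl// lerD2l (mulrC 2) -mulrA ler_wpM2l ?nrm_ge0//.
apply: le_trans Ule _; rewrite ler_wpM2l// -Rintegral_itv_split//.
- by rewrite (le_trans history_start_le)// gerBl ltW.
- exact: input_norm_integrable.
Qed.

(** [predictor_le] and [input_le] bound [|X| + |U|] by [1 + |K| e] times [|X|] plus [|K| e |B|]
    times the integral of [|U|]; inserting [state_le] produces this coefficient of [past], and
    [growth_rate] as the coefficient of the integral of [|X| + |U|]. *)
Definition growth_const :=
  (1 + nrm K * e) * (1 + 2 * nrm B) + nrm K * (e * nrm B).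
Definition growth_rate :=
  (1 + nrm K * e) * (nrm A + 2 * nrm B) + nrm K * (e * nrm B).

Lemma growth_const_ge0 : 0 <= growth_const.
Proof. by rewrite /growth_const; repeat (apply: addr_ge0 || apply: mulr_ge0); rewrite ?nrm_ge0// ltW. Qed.

Lemma growth_rate_ge0 : 0 <= growth_rate.
Proof. by rewrite /growth_rate; repeat (apply: addr_ge0 || apply: mulr_ge0); rewrite ?nrm_ge0// ltW. Qed.

Lemma growth t : t0 <= t ->
  nrm (X t) + `|U t| <= growth_const * past * expR (growth_rate * (t - t0)).
Proof.
move=> t0t.
pose y s := nrm (X (Num.max t0 s)) + `|U (Num.max t0 s)|.
have yE s : t0 <= s -> y s = nrm (X s) + `|U s| by move=> /max_r; rewrite /y => ->.
rewrite -yE//.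
apply: (gronwall _ growth_rate_ge0 _ t0t).
  move=> s; apply: cvgD; first exact: (continuous_nrm clamp_state_continuous).
  by apply: cvg_norm; exact: clamp_input_continuous0.
move=> {t0t}t t0t.
have h0t0 : h0 <= t0 by rewrite (le_trans history_start_le)// gerBl ltW.
have -> : \int[mu]_(s in `[t0, t]) y s =
    \int[mu]_(s in `[t0, t]) nrm (X s) + \int[mu]_(s in `[t0, t]) `|U s|.
  rewrite -RintegralD//; first 1 last.
  - exact: state_norm_integrable.
  - exact: input_norm_integrable.
  by apply: eq_Rintegral => s; rewrite inE/= in_itv/= => /andP[t0s _]; rewrite yE.
rewrite yE//.
have Xle := state_le t0t.
have Zle := predictor_le t0t.
have Ule := input_le t0t.
have Ile := input_integral_le t0t.
have SX0 : 0 <= \int[mu]_(s in `[t0, t]) nrm (X s).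
  by apply: Rintegral_ge0 => x _; exact: nrm_ge0.
have SU0 : 0 <= \int[mu]_(s in `[t0, t]) `|U s|.
  by apply: Rintegral_ge0 => x _; exact: normr_ge0.
move: Xle Zle Ule Ile SX0 SU0 past_input_ge0 (nrm_ge0 (X t0)) (nrm_ge0 K) (nrm_ge0 A) (nrm_ge0 B).
rewrite /growth_const /growth_rate /past.
move: (\int[mu]_(s in `[t0, t]) nrm (X s)) (\int[mu]_(s in `[t0, t]) `|U s|)
  (\int[mu]_(s in `[t - Dh, t]) `|U s|) h (nrm (X t0)) (nrm (X t)) (nrm (Z t)) (`|U t|)
  (nrm A) (nrm B) (nrm K).
move=> SX SU SI hh x0 x z u a b k Xle Zle Ule Ile SX0 SU0 hh0 x00 k0 a0 b0.
have eb0 : 0 <= e * b by rewrite mulr_ge0// ltW.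
have Z2 : z <= e * x + e * b * (hh + SU).
  by apply: le_trans Zle _; rewrite lerD2l; exact: ler_wpM2l.
have U1 : u <= k * (e * x) + k * (e * b) * (hh + SU).
  by apply: le_trans Ule _; have := ler_wpM2l k0 Z2; lra.
set c := 1 + k * e.
have e0' : 0 <= e := ltW e0.
have c0 : 0 <= c by apply: addr_ge0 => //; exact: mulr_ge0.
set d := k * (e * b).
have d0 : 0 <= d by exact: mulr_ge0.
have S1 : x + u <= c * x + d * (hh + SU) by move: U1; rewrite -/d /c; lra.
have S2 := ler_wpM2l c0 Xle.
have p1 : 0 <= c * b * x0 by rewrite !mulr_ge0.
have p2 : 0 <= d * x0 by rewrite !mulr_ge0.
have p3 : 0 <= c * hh by rewrite !mulr_ge0.
have p4 : 0 <= c * b * SX by rewrite !mulr_ge0.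
have p5 : 0 <= d * SX by rewrite !mulr_ge0.
have p6 : 0 <= c * a * SU by rewrite !mulr_ge0.
apply: le_trans S1 _; move: S2 p1 p2 p3 p4 p5 p6; move: c d {c0 d0} => c d; lra.
Qed.

(** * The transient in terms of the initial energy *)

Definition initial_energy := enorm (X t0) ^+ 2 + \int[mu]_(s in `[h0, t0]) (U s ^+ 2).
Notation P := initial_energy.

(** Gronwall's inequality is linear in the [L^1] size of the data, while the energy is quadratic.
    Cauchy-Schwarz on the recorded interval, of length at most [2 * Dh], gives [4 * Dh]; [n] comes
    from comparing the sum norm with the Euclidean one. *)
Lemma past_sqr_le : past ^+ 2 <= (2 * n%:R + 4 * Dh) * P.
Proof.
have h0t0 : h0 <= t0 by rewrite (le_trans history_start_le)// gerBl ltW.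
have len : t0 - h0 <= 2 * Dh by have := history_start_ge; move: d1Dh; lra.
have S0 : 0 <= \int[mu]_(s in `[h0, t0]) (U s ^+ 2).
  by apply: Rintegral_ge0 => x _; exact: sqr_ge0.
have := Rintegral_norm_sqr_le h0t0 U_L2; rewrite -/h /initial_energy.
have := sqr_nrm_le (X t0); rewrite -dotv_enorm /past.
move: S0; move: (\int[mu]_(s in `[h0, t0]) (U s ^+ 2)) (enorm (X t0) ^+ 2) (sqr_ge0 (enorm (X t0))).
move=> S x x0 S0 X1 H.
have H2 : h ^+ 2 <= 2 * Dh * S by apply: le_trans H _; rewrite ler_wpM2r.
have : (nrm (X t0) + h) ^+ 2 <= 2 * nrm (X t0) ^+ 2 + 2 * h ^+ 2.
  rewrite -subr_ge0.
  have -> : 2 * nrm (X t0) ^+ 2 + 2 * h ^+ 2 - (nrm (X t0) + h) ^+ 2 = (nrm (X t0) - h) ^+ 2.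
    by ring.
  exact: sqr_ge0.
move=> /le_trans; apply.
have nS : 0 <= n%:R * S by rewrite mulr_ge0.
have Dx : 0 <= Dh * x by rewrite mulr_ge0// ltW.
move: H2 X1 nS Dx; lra.
Qed.

Definition transient_const := growth_const * expR (growth_rate * (3 * Dh)).
Definition predictor_const :=
  e * transient_const + e * nrm B * (1 + 3 * Dh * transient_const).

Lemma transient_const_ge0 : 0 <= transient_const.
Proof. by rewrite mulr_ge0 ?growth_const_ge0 ?expR_ge0. Qed.

Lemma transient_le t : t0 <= t -> t <= t0 + 3 * Dh ->
  nrm (X t) + `|U t| <= transient_const * past.
Proof.
move=> t0t tT; apply: le_trans (growth t0t) _.
rewrite /transient_const mulrAC ler_wpM2r ?past_ge0// ler_wpM2l ?growth_const_ge0//.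
by rewrite ler_expR ler_wpM2l ?growth_rate_ge0//; lra.
Qed.

Lemma predictor_transient_le t : t0 <= t -> t <= t0 + 3 * Dh ->
  nrm (Z t) <= predictor_const * past.
Proof.
move=> t0t tT; apply: le_trans (predictor_le t0t) _.
have eb0 : 0 <= e * nrm B by rewrite mulr_ge0 ?nrm_ge0// ltW.
rewrite mulrDl; apply: lerD.
  rewrite -mulrA; apply: (ler_wpM2l (ltW e0)); apply: le_trans (transient_le t0t tT).
  by rewrite lerDl.
rewrite -(mulrA (e * nrm B)); apply: (ler_wpM2l eb0).
apply: le_trans (input_integral_le t0t) _; rewrite mulrDl mul1r; apply: lerD.
  by rewrite /past lerDr nrm_ge0.
have h0t0 : h0 <= t0 by rewrite (le_trans history_start_le)// gerBl ltW.
apply: (@le_trans _ _ (transient_const * past * (t - t0))).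
  apply: Rintegral_le_itv => //; first exact: input_norm_integrable.
  move=> x t0x xt; apply: le_trans (transient_le t0x (le_trans xt tT)).
  by rewrite lerDr nrm_ge0.
rewrite [leRHS](_ : _ = transient_const * past * (3 * Dh)); last by ring.
apply: ler_wpM2l; last by move: tT; lra.
exact: mulr_ge0 transient_const_ge0 past_ge0.
Qed.

(* Factoring e^(A t) out of the kernel leaves integrands independent of t, to
   which the fundamental theorem of calculus applies. *)
Definition weighted_input t := integral_cv `[t0 - Dh, t] (fun s => U s *: (E (- s) *m B)).
Notation H := weighted_input.

Lemma expmx_opp_continuous_at t i : {for t, continuous (fun s : R => (E (- s) *m B) i 0)}.
Proof.
apply: (@continuous_mulmx _ _ _ _ (fun s : R => E (- s)) (fun=> B)) => [k j|k j] x; last exact: cvg_cst.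
rewrite (_ : (fun s : R => _) = fun s : R => E (0 - s) k j).
  exact: (mderiv_continuous (dF := fun s => - (A *m E (0 - s))) (mderiv_expmx_opp A 0 x)).
by apply/funext => s; rewrite sub0r.
Qed.

Lemma weighted_input_integrable a b i : t0 - Dh <= a ->
  mu.-integrable `[a, b] (EFin \o (fun s => (U s *: (E (- s) *m B)) i 0)).
Proof.
move=> ha.
pose f s := U (Num.max (t0 - Dh) s) * (E (- s) *m B) i 0.
have cf : continuous f.
  by move=> s; apply: cvgM; [exact: clamp_input_continuous|exact: expmx_opp_continuous_at].
have := continuous_integrable_itv a b cf.
apply: eq_integrable => // s; rewrite inE/= in_itv/= => /andP[as_ _].
by rewrite /f /= [in RHS]mxE max_r// (le_trans ha).
Qed.

Lemma integral_cv_mulmx m p (M : 'M[R]_(m, p)) (D : set R) (f : R -> 'cV[R]_p) :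
  measurable D -> (forall i, mu.-integrable D (EFin \o (fun s => f s i 0))) ->
  M *m integral_cv D f = integral_cv D (fun s => M *m f s).
Proof.
move=> mD fi; apply/matrixP => i j; rewrite !mxE.
have fi' k : mu.-integrable D (EFin \o (fun s => M i k * f s k 0)).
  exact: integrable_scaler.
have [_ Es] := Rintegral_sum (index_enum 'I_p) mD fi'.
transitivity (\int[mu]_(s in D) (\sum_k M i k * f s k 0)).
  rewrite Es; apply: eq_bigr => k _; rewrite mxE RintegralZl//.
by apply: eq_Rintegral => s _; rewrite mxE.
Qed.

Lemma predictor_integralE t : t0 <= t -> I t = E t *m (H t - H (t - Dh)).
Proof.
move=> t0t.
have ha : t0 - Dh <= t - Dh by rewrite lerB.
have hb : t - Dh <= t by rewrite gerBl ltW.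
have -> : H t - H (t - Dh) = integral_cv `[t - Dh, t] (fun s => U s *: (E (- s) *m B)).
  apply/matrixP => i j; rewrite !mxE (@Rintegral_itv_split _ _ _ (t - Dh))//; last first.
    exact: weighted_input_integrable.
  by rewrite addrAC subrr add0r.
rewrite integral_cv_mulmx//; last by move=> i; exact: weighted_input_integrable.
apply/matrixP => i j; rewrite !mxE; apply: eq_Rintegral => s _.
by rewrite -scalemxAr mulmxA -expmxD.
Qed.

Lemma mderiv_weighted_input t : t0 - Dh < t -> mderiv H t (U t *: (E (- t) *m B)).
Proof.
move=> ht i j; rewrite (ord1 j).
apply: (@is_derive_ext _ (fun s => \int[mu]_(x in `[t0 - Dh, s]) (U x *: (E (- x) *m B)) i 0)).
  by move=> s; rewrite mxE.
have cf : {for t, continuous (fun x => (U x *: (E (- x) *m B)) i 0)}.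
  have -> : (fun x => (U x *: (E (- x) *m B)) i 0) = (fun x => U x * (E (- x) *m B) i 0).
    by apply/funext => x; rewrite mxE.
  by apply: cvgM; [exact: input_continuous_at|exact: expmx_opp_continuous_at].
exact: (is_derive_Rintegral ht (weighted_input_integrable (t + 1) i (lexx _)) cf).
Qed.

Lemma mderiv_near m p (F G : R -> 'M[R]_(m, p)) t d :
  (\forall s \near t, F s = G s) -> mderiv F t d -> mderiv G t d.
Proof.
move=> FG dF i j; apply: near_eq_is_derive (dF i j).
by apply: filterS FG => s ->.
Qed.

(** * The differential equation of the predictor and the size of the mismatch *)

Definition mismatch t := U (phi t) - U (t - Dh).
Notation w := mismatch.
Definition closed_loop_mx := A + B *m K.
Notation M := closed_loop_mx.
Notation G := (E Dh *m B).

Lemma mderiv_predictor t : t0 < t -> mderiv X t (A *m X t + U (phi t) *: B) ->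
  mderiv Z t (M *m Z t + w t *: G).
Proof.
move=> t0t dX.
have hs : is_derive t (1 : R) (fun s : R => s - Dh) 1.
  apply: is_derive_eq (is_deriveB (is_derive_id t 1) (is_derive_cst Dh t 1)) _.
  by rewrite subr0.
have hD : t0 - Dh < t - Dh by rewrite ltrD2r.
have ht : t0 - Dh < t by rewrite (lt_trans hD)// gtrBl.
have dH := mderiv_weighted_input ht.
have dHs := @mderiv_comp _ _ _ H (fun s => s - Dh) t _ _ (mderiv_weighted_input hD) hs.
have dI := mderivM (mderiv_expmx A t) (mderivD dH (mderivN dHs)).
have dZ := mderivD (mderivMl (E Dh) dX) dI.
apply: mderiv_near; last apply: mderiv_eq dZ _.
  near=> s; have t0s : t0 <= s by apply: ltW; near: s; exact: lt_nbhsr.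
  by rewrite /predictor predictor_integralE.
have E1 : E t *m (E (- t) *m B) = B by rewrite mulmxA -expmxD subrr expmx0 mul1mx.
have E2 : E t *m (E (- (t - Dh)) *m B) = G.
  by rewrite mulmxA -expmxD opprB addrCA subrr addr0.
(* The control law turns the boundary term at [t] into [B K Z]; the one at [t - Dh] combines with
   the delayed input into [w]. *)
have UB : U t *: B = B *m (K *m Z t).
  by rewrite (mx11_scalar (K *m Z t)) mul_mx_scalar -U_eq// ltW.
have EI : A *m E t *m (H t + - H (t - Dh)) = A *m I t.
  by rewrite -mulmxA -predictor_integralE// ltW.
have gen : forall (Et : 'M[R]_n) (b1 b2 : 'cV[R]_n) (u1 u2 : R),
    Et *m (u1 *: b1 - 1 *: (u2 *: b2)) = u1 *: (Et *m b1) - u2 *: (Et *m b2).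
  by move=> *; rewrite scale1r mulmxDr mulmxN -!scalemxAr.
have EU : E t *m (U t *: (E (- t) *m B) + - (1 *: (U (t - Dh) *: (E (- (t - Dh)) *m B)))) =
    U t *: B - U (t - Dh) *: G.
  by rewrite gen E1 E2.
have EX : E Dh *m (A *m X t + U (phi t) *: B) = A *m (E Dh *m X t) + U (phi t) *: G.
  by rewrite mulmxDr mulmxA expmx_comm -mulmxA -scalemxAr.
have EM : M *m Z t = A *m (E Dh *m X t) + A *m I t + U t *: B.
  by rewrite mulmxDl -mulmxA -UB /predictor mulmxDr.
rewrite EX EM /= EI EU /mismatch.
move: (A *m (E Dh *m X t)) (A *m I t) G => x y g.
by apply/matrixP => i j; rewrite !mxE; ring.
Unshelve. all: by end_near. Qed.

Lemma is_derive_input t d : t0 < t -> mderiv Z t d -> is_derive t (1 : R) U ((K *m d) 0 0).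
Proof.
move=> t0t dZ; have dKZ := mderivMl K dZ 0 0.
apply: near_eq_is_derive dKZ; near=> s.
by rewrite U_eq//; apply: ltW; near: s; exact: lt_nbhsr.
Unshelve. all: by end_near. Qed.

Lemma state_continuous_at t i j : t0 < t -> {for t, continuous (fun s => X s i j)}.
Proof.
rewrite (ord1 j).
have [+ _] := (continuous_within_itvcyP _ _).1 (ac_within_continuous (X_ac i)).
by move=> Hc tt; apply: Hc; rewrite in_itv/= andbT.
Qed.

(** After [t0 + Dh] the delayed time exceeds [t0 - Dh], where [U] is continuous. The right-hand side
    is then continuous at [t], and the plant equation holds at every such time, not just almost
    everywhere. *)
Lemma mderiv_state t : t0 + Dh < t -> mderiv X t (A *m X t + U (phi t) *: B).
Proof.
move=> tt i j; rewrite (ord1 j).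
have t0t : t0 < t by rewrite (lt_trans _ tt)// ltrDl.
pose f s := (A *m X s + U (phi s) *: B) i 0.
have cf : {for t, continuous f}.
  have -> : f = (fun s => \sum_k A i k * X s k 0 + U (phi s) * B i 0).
    by apply/funext => s; rewrite /f !mxE.
  apply: cvgD.
    by apply: (@cvg_sum_fun R) => k; apply: cvgMr; exact: state_continuous_at.
  apply: cvgMl; apply: (@continuous_comp _ _ _ phi U); first exact: delayed_continuous.
  by apply: input_continuous_at; have := delayed_ge t; move: tt Dh0; lra.
have [//|fi _] := @state_integral (t + 1); first by rewrite (le_trans (ltW t0t))// lerDl.
apply: (near_eq_is_derive (f := fun s => X t0 i 0 + \int[mu]_(x in `[t0, s]) f x)).
  near=> s; have t0s : t0 <= s by apply: ltW; near: s; exact: lt_nbhsr.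
  by have [_ ->] := state_integral t0s; rewrite !mxE.
apply: is_derive_eq (is_deriveD (is_derive_cst (X t0 i 0) t 1) (is_derive_Rintegral t0t (fi i) cf)) _.
by rewrite add0r.
Unshelve. all: by end_near. Qed.

Lemma predictor_ode t : t0 + Dh < t -> mderiv Z t (M *m Z t + w t *: G).
Proof.
move=> tt; apply: mderiv_predictor; last exact: mderiv_state.
by rewrite (lt_trans _ tt)// ltrDl.
Qed.

(** A bound on [|U'|] for [|Z| <= 1] on the window: [U' = K (M Z + w G)] with the crude estimate
    [|w| <= 2 |K|]. *)
Definition mismatch_const := nrm K * (nrm M + 2 * nrm K * nrm G).

Lemma mismatch_const_ge0 : 0 <= mismatch_const.
Proof. by rewrite !(mulr_ge0, addr_ge0, nrm_ge0). Qed.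

Lemma norm_mismatch_le s rho : (forall r, s - Dh * (3 / 2) <= r -> r <= s -> `|U r| <= rho) ->
  `|w s| <= 2 * rho.
Proof.
move=> Hr; rewrite mulrDl mul1r; apply: le_trans (ler_normB _ _) _; apply: lerD; apply: Hr.
- by have := delayed_ge s; move: Dh0; lra.
- by have := delayed_le s; move: Dh0; lra.
- by move: Dh0; lra.
- by move: Dh0; lra.
Qed.

(** A crude bound on [w] over the last [3/2 * Dh] bounds [U'] there. The mean value theorem between
    [phi t] and [t - Dh], at distance [|dl t| <= d1], then improves it to a bound of order [d1]. *)
Lemma mismatch_le t rho : t0 + 3 * Dh < t ->
  (forall s, t - 3 * Dh <= s -> s <= t -> nrm (Z s) <= rho) ->
  `|w t| <= d1 * (mismatch_const * rho).
Proof.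
move=> tt Zr.
have rho0 : 0 <= rho.
  by apply: le_trans (nrm_ge0 (Z t)) (Zr t _ _) => //; move: Dh0; lra.
have lo s : t - Dh * (3 / 2) <= s -> s <= t -> `|w s| <= 2 * (nrm K * rho).
  move=> ts st; apply: norm_mismatch_le => r sr rs.
  apply: le_trans (input_le _) _; first by move: Dh0; lra.
  by rewrite ler_wpM2l ?nrm_ge0//; apply: Zr; move: Dh0; lra.
pose df s := (K *m (M *m Z s + w s *: G)) 0 0.
have dU s : t - Dh * (3 / 2) <= s -> is_derive s (1 : R) U (df s).
  by move=> ts; apply: is_derive_input; [|apply: predictor_ode]; move: Dh0; lra.
have dfle s : t - Dh * (3 / 2) <= s -> s <= t -> `|df s| <= mismatch_const * rho.
  move=> ts st; apply: le_trans (entry_le_nrm _ _ _) _; apply: le_trans (ler_nrmM _ _) _.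
  rewrite /mismatch_const -mulrA ler_wpM2l ?nrm_ge0//.
  apply: le_trans (ler_nrmD _ _) _; rewrite nrmZ mulrDl; apply: lerD.
    apply: le_trans (ler_nrmM _ _) _; rewrite ler_wpM2l ?nrm_ge0//.
    by apply: Zr => //; move: Dh0; lra.
  have -> : 2 * nrm K * nrm G * rho = 2 * (nrm K * rho) * nrm G by ring.
  by rewrite ler_wpM2r ?nrm_ge0// lo.
have mvt a b : t - Dh * (3 / 2) <= a -> a <= b -> b <= t -> b - a <= d1 ->
    `|U b - U a| <= d1 * (mismatch_const * rho).
  move=> ta ab bt bad.
  have dab x : x \in `]a, b[ -> is_derive x 1 U (df x).
    by rewrite in_itv/= => /andP[ax _]; apply: dU; exact: le_trans ta (ltW ax).
  have cab : {within `[a, b], continuous U}.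
    apply: continuous_subspaceW input_within_continuous.
    move=> x /=; rewrite !in_itv/= andbT => /andP[ax _].
    by apply: le_trans ax; move: Dh0; lra.
  have [c + ->] := MVT_segment ab dab cab.
  rewrite in_itv/= => /andP[ac cb].
  rewrite normrM mulrC (ger0_norm (_ : 0 <= b - a)) ?subr_ge0//.
  apply: ler_pM => //; first by rewrite subr_ge0.
  by apply: dfle; [exact: le_trans ta ac|exact: le_trans cb bt].
have := dl_le t; rewrite ler_norml => /andP[dm dp].
have pl := delayed_le t; have pg := delayed_ge t.
rewrite /mismatch; have [pt|/ltW pt] := leP (phi t) (t - Dh).
  by rewrite distrC; apply: mvt => //; move: Dh0 dm dp; rewrite /delayed; lra.
by apply: mvt => //; move: Dh0 d1Dh dm dp pl; rewrite /delayed; lra.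
Qed.

Lemma weighted_input_continuous i j :
  continuous (fun t => H (Num.max (t0 - Dh) t) i j).
Proof.
rewrite (ord1 j).
apply: (@continuous_clamp _ (t0 - Dh) (fun t => H t i 0)); apply: ac_within_continuous.
exists (fun s => (U s *: (E (- s) *m B)) i 0) => b tb; split.
  exact: weighted_input_integrable.
by rewrite !mxE set_itv1 Rintegral_set1 add0r.
Qed.

Lemma clamp_predictor_continuous i j : continuous (fun t => Z (Num.max t0 t) i j).
Proof.
have cm : continuous (fun t : R => Num.max t0 t).
  by move=> t; apply: (@continuous_max _ _ (cst t0) id t); [exact: cst_continuous|].
pose Hc t := H (Num.max (t0 - Dh) t).
have -> : (fun t => Z (Num.max t0 t) i j) = (fun t => (E Dh *m X (Num.max t0 t)) i j +
    (E (Num.max t0 t) *m (Hc (Num.max t0 t) - Hc (Num.max t0 t - Dh))) i j).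
  apply/funext => t; have t0m : t0 <= Num.max t0 t by rewrite le_max lexx.
  move: (Num.max t0 t) t0m => r t0r.
  have e1 : Num.max (t0 - Dh) r = r by apply/max_r; rewrite (le_trans _ t0r)// gerBl ltW.
  have e2 : Num.max (t0 - Dh) (r - Dh) = r - Dh by apply/max_r; rewrite lerB.
  by rewrite /predictor predictor_integralE// mxE /Hc e1 e2.
move=> t; apply: cvgD.
  apply: (@continuous_mulmx _ _ _ _ (fun=> E Dh)); last exact: clamp_state_continuous.
  by move=> k l s; exact: cvg_cst.
apply: (@continuous_mulmx _ _ _ _ (fun s => E (Num.max t0 s))
  (fun s => Hc (Num.max t0 s) - Hc (Num.max t0 s - Dh))) => k l s.
  apply: (@continuous_comp _ _ _ (Num.max t0) (fun s => E s k l)); first exact: cm.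
  exact: expmx_continuous.
have -> : (fun s => (Hc (Num.max t0 s) - Hc (Num.max t0 s - Dh)) k l) =
    (fun s => Hc (Num.max t0 s) k l - Hc (Num.max t0 s - Dh) k l).
  by apply/funext => x; rewrite !mxE.
apply: cvgB.
  apply: (@continuous_comp _ _ _ (Num.max t0) (fun s => Hc s k l)); first exact: cm.
  exact: weighted_input_continuous.
apply: (@continuous_comp _ _ _ (fun s => Num.max t0 s - Dh) (fun s => Hc s k l)).
  by apply: cvgB; [exact: cm|exact: cvg_cst].
exact: weighted_input_continuous.
Qed.

Lemma is_derive_dotv m (F : R -> 'cV[R]_m) t dF : mderiv F t dF ->
  is_derive t (1 : R) (fun s => dotv (F s) (F s)) (2 * dotv (F t) dF).
Proof.
move=> dF'.
have d i : is_derive t (1 : R) (fun s => F s i 0 * F s i 0) (dF i 0 * F t i 0 + F t i 0 * dF i 0).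
  exact: is_derive_mul_fun.
apply: is_derive_eq (is_derive_sum_fun d) _.
by rewrite /dotv mulr_sumr; apply: eq_bigr => i _; ring.
Qed.

(** * Decay of the Lyapunov function *)

Variables (m : nat) (L : 'M[R]_(m, n)) (al : R).
Hypotheses (al0 : 0 < al) (L_ge : forall x, dotv x x <= dotv (L *m x) (L *m x)).
Hypothesis L_decr : forall x,
  2 * dotv (L *m x) (L *m (M *m x)) <= - al * dotv (L *m x) (L *m x).

Notation V t := (dotv (L *m Z t) (L *m Z t)).

(** The factor by which the weight [e^(al / 2 * t)] changes over a window of length [3 * Dh]. *)
Definition window_factor := expR (al / 2 * (3 * Dh)).
Definition coupling_const :=
  mismatch_const * (nrm L * nrm (L *m G)) * (n%:R * window_factor).

Lemma window_factor_ge1 : 1 <= window_factor.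
Proof. by rewrite -expR0 ler_expR !mulr_ge0 ?invr_ge0// ltW. Qed.

Hypothesis d1_small : 2 * (d1 * coupling_const) < al / 2.

Lemma sqr_nrm_predictor_le t : nrm (Z t) ^+ 2 <= n%:R * V t.
Proof. by apply: le_trans (sqr_nrm_le _) _; rewrite ler_wpM2l. Qed.

(** While the window is dominated by the present value, the mismatch contributes at most
    [2 * d1 * coupling_const * V], less than half of the decay [al * V]; the remaining half pays for
    the derivative of the weight. *)
Lemma lyapunov_record t : t0 + 3 * Dh < t -> 0 < V t ->
  (forall s, t - 3 * Dh <= s -> s <= t -> V s <= V t * window_factor) ->
  2 * dotv (L *m Z t) (L *m (M *m Z t + w t *: G)) + al / 2 * V t < 0.
Proof.
move=> tt Vt Hs.
(* The bound on [|Z|] over the window that follows from [|Z|^2 <= n V]. Its square brings the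
   mismatch term back to a multiple of [V t]. *)
pose rho := Num.sqrt (n%:R * (V t * window_factor)).
have Wf := lt_le_trans ltr01 window_factor_ge1.
have q0 : 0 <= n%:R * (V t * window_factor) by rewrite !mulr_ge0// ltW.
have rho2 : rho * rho = n%:R * (V t * window_factor) by rewrite -expr2 sqr_sqrtr.
have Zr s : t - 3 * Dh <= s -> s <= t -> nrm (Z s) <= rho.
  move=> ts st; rewrite -(ger0_norm (nrm_ge0 (Z s))) -sqrtr_sqr ler_sqrt//.
  by apply: le_trans (sqr_nrm_predictor_le s) _; rewrite ler_wpM2l// Hs.
have wle := mismatch_le tt Zr.
have Zt : nrm (Z t) <= rho by apply: Zr => //; move: Dh0; lra.
have rho0 : 0 <= rho by exact: sqrtr_ge0.
have D2 : dotv (L *m Z t) (L *m (w t *: G)) <= d1 * coupling_const * V t.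
  apply: le_trans (dotv_le_nrm _ _) _; rewrite -scalemxAr nrmZ.
  apply: (@le_trans _ _ (nrm L * rho * (d1 * (mismatch_const * rho) * nrm (L *m G)))).
    apply: ler_pM; rewrite ?nrm_ge0 ?mulr_ge0 ?nrm_ge0//.
      by apply: le_trans (ler_nrmM _ _) _; rewrite ler_wpM2l ?nrm_ge0.
    by rewrite ler_wpM2r ?nrm_ge0.
  rewrite le_eqVlt; apply/orP; left; apply/eqP; rewrite /coupling_const.
  rewrite [LHS](_ : _ = d1 * mismatch_const * nrm L * nrm (L *m G) * (rho * rho)); last by ring.
  by rewrite rho2; ring.
have D1 := L_decr (Z t).
have small : 2 * (d1 * coupling_const) * V t < al / 2 * V t by rewrite ltr_pM2r.
rewrite mulmxDr dotvDr; move: D1 D2 small.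
move: (V t) (dotv (L *m Z t) (L *m (M *m Z t))) (dotv (L *m Z t) (L *m (w t *: G))).
by move=> v x y; lra.
Qed.

(** The bound of [V] on the transient in terms of the initial energy, times [window_factor], the
    largest value of the weight there. *)
Definition decay_const := (nrm L * predictor_const) ^+ 2 * window_factor *
  (2 * n%:R + 4 * Dh).

Lemma lyapunov_decay t : t0 <= t -> V t <= decay_const * P * expR (- (al / 2) * (t - t0)).
Proof.
move=> t0t.
pose f s := V (Num.max t0 s) * expR (al / 2 * (s - t0)).
have fE s : t0 <= s -> f s = V s * expR (al / 2 * (s - t0)) by rewrite /f => /max_r ->.
have P0 : 0 <= P.
  by rewrite addr_ge0 ?sqr_ge0//; apply: Rintegral_ge0 => x _; exact: sqr_ge0.
have C0 : 0 <= decay_const.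
  rewrite /decay_const mulr_ge0//.
    by rewrite mulr_ge0 ?sqr_ge0// (le_trans ler01 window_factor_ge1).
  by rewrite addr_ge0// mulr_ge0// ltW.
have al2 : 0 <= al / 2 by rewrite divr_ge0// ltW.
suff : f t <= decay_const * P.
  by rewrite fE// mulNr expRN -ler_pdivlMr ?invr_gt0 ?expR_gt0// invrK.
apply: (@bounded_of_decreasing_at_records _ f t0 (t0 + 3 * Dh)) => //.
- have cexp : continuous (fun s : R => expR (al / 2 * (s - t0))).
    move=> x; apply: continuous_comp; last exact: continuous_expR.
    by apply: cvgMr; apply: cvgB => //; exact: cvg_cst.
  move=> s; apply: cvgM; last exact: cexp.
  apply: (@cvg_sum_fun R) => k.
  have cL : continuous (fun s => (L *m Z (Num.max t0 s)) k 0).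
    apply: (@continuous_mulmx _ _ _ _ (fun=> L)); last exact: clamp_predictor_continuous.
    by move=> a b x; exact: cvg_cst.
  by apply: cvgM; exact: cL.
- by rewrite lerDl mulr_ge0// ltW.
- move=> s t0s st; rewrite fE//.
  have Zs := predictor_transient_le t0s st.
  have LZ : nrm (L *m Z s) <= nrm L * predictor_const * past.
    apply: le_trans (ler_nrmM _ _) _; rewrite -mulrA ler_wpM2l ?nrm_ge0//.
  have Vs : V s <= (nrm L * predictor_const) ^+ 2 * ((2 * n%:R + 4 * Dh) * P).
    apply: le_trans (dotv_le_nrm _ _) _.
    apply: (@le_trans _ _ ((nrm L * predictor_const * past) ^+ 2)).
      by rewrite expr2; apply: ler_pM; rewrite ?nrm_ge0.
    by rewrite exprMn ler_wpM2l ?sqr_ge0// past_sqr_le.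
  have -> : decay_const * P = (nrm L * predictor_const) ^+ 2 * ((2 * n%:R + 4 * Dh) * P) *
      window_factor by rewrite /decay_const; ring.
  apply: ler_pM => //; first exact: dotv_ge0.
  by rewrite ler_expR; apply: ler_wpM2l => //; move: st; lra.
- exact: mulr_ge0.
- move=> s ts fs0 Hrec.
  have t0s : t0 < s by rewrite (le_lt_trans _ ts)// lerDl mulr_ge0// ltW.
  have Ve : 0 < expR (al / 2 * (s - t0)) by exact: expR_gt0.
  have Vs : 0 < V s by move: fs0; rewrite fE ?ltW// pmulr_lgt0.
  have dZ : mderiv Z s (M *m Z s + w s *: G).
    by apply: predictor_ode; move: ts Dh0; lra.
  have dV := is_derive_dotv (mderivMl L dZ).
  have dE : is_derive s (1 : R) (fun x : R => expR (al / 2 * (x - t0)))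
      (al / 2 * expR (al / 2 * (s - t0))).
    by apply: is_derive_eq; rewrite /GRing.scale/=; ring.
  exists ((2 * dotv (L *m Z s) (L *m (M *m Z s + w s *: G)) + al / 2 * V s) *
      expR (al / 2 * (s - t0))).
    rewrite pmulr_llt0//; apply: lyapunov_record => // r sr rs.
    have t0r : t0 <= r by move: ts sr; lra.
    (* A record of the weighted function gives [V r <= V s * e^(al / 2 * (s - r))], and the
       exponential is at most [window_factor] since [s - r <= 3 * Dh]. *)
    have := Hrec r t0r rs; rewrite !fE ?(ltW t0s)// => Hr.
    rewrite -(ler_pM2r (expR_gt0 (al / 2 * (r - t0)))); apply: le_trans Hr _.
    rewrite -(mulrA (V s)); apply: (ler_wpM2l (ltW Vs)).
    rewrite /window_factor -expRD ler_expR -mulrDr; apply: ler_wpM2l => //.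
    by move: sr; lra.
  apply: (near_eq_is_derive (f := fun x => V x * expR (al / 2 * (x - t0)))).
    near=> x; rewrite fE//; apply: ltW; near: x; exact: lt_nbhsr.
  apply: is_derive_eq (is_derive_mul_fun dV dE) _; ring.
Unshelve. all: by end_near. Qed.

(** * Recovering the state and the input *)

Notation decay t := (expR (- (al / 2) * (t - t0))).

Lemma initial_energy_ge0 : 0 <= P.
Proof.
by rewrite addr_ge0 ?sqr_ge0//; apply: Rintegral_ge0 => x _; exact: sqr_ge0.
Qed.

Lemma decay_const_ge0 : 0 <= decay_const.
Proof.
rewrite /decay_const mulr_ge0//.
  by rewrite mulr_ge0 ?sqr_ge0// (le_trans ler01 window_factor_ge1).
by rewrite addr_ge0// mulr_ge0// ltW.
Qed.

Lemma decay_window s t : t - 3 * Dh <= s -> decay s <= decay t * window_factor.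
Proof.
move=> ts; rewrite /window_factor -expRD ler_expR.
have al2 : 0 <= al / 2 by rewrite divr_ge0// ltW.
have := mulr_ge0 al2 (_ : 0 <= s - (t - 3 * Dh)); rewrite subr_ge0 => /(_ ts).
by move: (al / 2) => a; lra.
Qed.

(** Lets quantities fixed at time [t0] be charged to the decaying bound, as long as they enter the
    window. *)
Lemma decay_early t : t <= t0 + 3 * Dh -> 1 <= decay t * window_factor.
Proof.
move=> tt; have /decay_window : t - 3 * Dh <= t0 by move: tt; lra.
by rewrite subrr mulr0 expR0.
Qed.

Lemma sqr_predictor_decay t : t0 <= t ->
  nrm (Z t) ^+ 2 <= n%:R * decay_const * P * decay t.
Proof.
move=> t0t; apply: le_trans (sqr_nrm_predictor_le t) _.
by have := ler_wpM2l (ler0n R n) (lyapunov_decay t0t); rewrite !mulrA.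
Qed.

Definition input_const := nrm K ^+ 2 * (n%:R * decay_const).

Lemma input_const_ge0 : 0 <= input_const.
Proof. by rewrite mulr_ge0 ?sqr_ge0// mulr_ge0// decay_const_ge0. Qed.

Lemma sqr_input_decay t : t0 <= t -> U t ^+ 2 <= input_const * P * decay t.
Proof.
move=> t0t; rewrite -[U t ^+ 2]real_normK ?num_real//.
apply: (@le_trans _ _ ((nrm K * nrm (Z t)) ^+ 2)).
  by rewrite !expr2; apply: ler_pM => //; exact: input_le.
rewrite exprMn /input_const.
have := ler_wpM2l (sqr_ge0 (nrm K)) (sqr_predictor_decay t0t).
by rewrite !(mulrA (nrm K ^+ 2)).
Qed.

(** Bounds from below all past times that enter the estimates at [t], without leaving the recorded
    past. *)
Definition window_start t := Num.max h0 (t - 3 * Dh).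
Notation ws := window_start.
Definition window_const := (1 + input_const * (3 * Dh)) * window_factor.

Lemma history_start_le0 : h0 <= t0.
Proof. by rewrite (le_trans history_start_le)// gerBl ltW. Qed.

Lemma sqr_input_integrable a b : h0 <= a ->
  mu.-integrable `[a, b] (EFin \o (fun s => U s ^+ 2)).
Proof. by move=> ha; have [] := input_square_integrable b ha. Qed.

Lemma window_le t : t0 <= t ->
  \int[mu]_(s in `[ws t, t]) (U s ^+ 2) <= window_const * P * decay t.
Proof.
move=> t0t.
have Dt0 : 0 <= decay t * window_factor by rewrite mulr_ge0 ?expR_ge0.
have CP0 : 0 <= input_const * P by rewrite mulr_ge0 ?input_const_ge0 ?initial_energy_ge0.
have late c : t0 <= c -> t - 3 * Dh <= c -> c <= t ->
    \int[mu]_(s in `[c, t]) (U s ^+ 2) <= input_const * P * (decay t * window_factor) * (3 * Dh).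
  move=> t0c tc ct.
  apply: (@le_trans _ _ (input_const * P * (decay t * window_factor) * (t - c))).
    apply: Rintegral_le_itv => //.
      by apply: sqr_input_integrable; exact: le_trans history_start_le0 t0c.
    move=> x cx xt; apply: le_trans (sqr_input_decay (le_trans t0c cx)) _.
    by apply: ler_wpM2l => //; apply: decay_window; exact: le_trans cx.
  by apply: ler_wpM2l; [exact: mulr_ge0|move: tc; lra].
have -> : window_const * P * decay t = P * (decay t * window_factor) +
    input_const * P * (decay t * window_factor) * (3 * Dh) by rewrite /window_const; ring.
rewrite /window_start; have [t3|t3] := leP t0 (t - 3 * Dh).
  rewrite (max_r (le_trans history_start_le0 t3)).
  apply: le_trans (late _ t3 (lexx _) _) _; first by move: Dh0; lra.
  by rewrite lerDr mulr_ge0 ?initial_energy_ge0.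
have ha : h0 <= Num.max h0 (t - 3 * Dh) by rewrite le_max lexx.
have at0 : Num.max h0 (t - 3 * Dh) <= t0 by rewrite ge_max history_start_le0 ltW.
(* Before [t0] only the total recorded energy is known; after [t0] the pointwise decay of [U]
   applies. These are the two summands of [window_const]. *)
rewrite (Rintegral_itv_split at0 t0t (sqr_input_integrable _ ha)); apply: lerD.
  apply: (@le_trans _ _ P).
    apply: (@le_trans _ _ (\int[mu]_(s in `[h0, t0]) (U s ^+ 2))).
      apply: Rintegral_le_subset => //.
      - by move=> x /=; rewrite !in_itv/= => /andP[ax ->]; rewrite (le_trans ha ax).
      - exact: sqr_input_integrable.
      - by move=> x _; exact: sqr_ge0.
    by rewrite /initial_energy lerDr sqr_ge0.
  by rewrite ler_peMr ?initial_energy_ge0// decay_early//; move: t3; lra.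
by apply: late => //; exact: ltW.
Qed.

Lemma window_sub_le t c : t0 <= t -> ws t <= c ->
  \int[mu]_(s in `[c, t]) (U s ^+ 2) <= window_const * P * decay t.
Proof.
move=> t0t wc; apply: le_trans (window_le t0t).
apply: Rintegral_le_subset => //.
- by move=> x /=; rewrite !in_itv/= => /andP[cx ->]; rewrite (le_trans wc cx).
- by apply: sqr_input_integrable; rewrite le_max lexx.
- by move=> x _; exact: sqr_ge0.
Qed.

Lemma input_window_le t : t0 <= t ->
  \int[mu]_(s in `[t - Dh - Num.max 0 (dl t), t]) (U s ^+ 2) <= window_const * P * decay t.
Proof.
move=> t0t; apply: window_sub_le => //.
have := dl_lip t0t; have := dl_le t; rewrite !ler_norml => /andP[_ dt] /andP[_ dtt].
have m1 : Num.max 0 (dl t) <= Dh / 2 by rewrite ge_max divr_ge0 ?(ltW Dh0)//= (le_trans dt).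
(* The excess delay grows more slowly than time, so the interval of [Pi_L] at [t] never starts
   before the one at [t0]. *)
have m2 : Num.max 0 (dl t) <= Num.max 0 (dl t0) + (t - t0).
  have a0 : 0 <= Num.max 0 (dl t0) by rewrite le_max lexx.
  have a1 : dl t0 <= Num.max 0 (dl t0) by rewrite le_max lexx orbT.
  by rewrite ge_max; apply/andP; split; move: t0t a0 a1 dtt; lra.
rewrite /window_start ge_max /history_start.
by apply/andP; split; move: m1 m2 Dh0; lra.
Qed.

Lemma window_start_le t : t0 <= t -> ws t <= t - Dh.
Proof.
move=> t0t; rewrite /window_start ge_max; apply/andP; split.
  by rewrite (le_trans history_start_le)// lerB.
by move: Dh0; lra.
Qed.

(** From [X = e^(- A Dh) (Z - I)], where [e] also bounds the backward exponential, with
    [(a + b)^2 <= 2 a^2 + 2 b^2] and Cauchy-Schwarz for [I] over a length [Dh]. *)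
Definition state_const := e ^+ 2 *
  (2 * (n%:R * decay_const) + 2 * ((e * nrm B) ^+ 2 * (Dh * window_const))).

Lemma state_decay t : t0 <= t -> enorm (X t) ^+ 2 <= state_const * P * decay t.
Proof.
move=> t0t.
have XE : X t = E (- Dh) *m (Z t - I t).
  rewrite /predictor addrK mulmxA -expmxD addNr.
  by rewrite expmx0 mul1mx.
have Xle : nrm (X t) <= e * (nrm (Z t) + e * nrm B * \int[mu]_(s in `[t - Dh, t]) `|U s|).
  rewrite {1}XE; apply: le_trans (ler_nrmM _ _) _; apply: ler_pM; rewrite ?nrm_ge0//.
    by apply: E_le; rewrite normrN ger0_norm// ltW.
  apply: le_trans (ler_nrmD _ _) _; rewrite nrmN lerD2l.
  exact: predictor_integral_le.
have h0t : h0 <= t - Dh by rewrite (le_trans history_start_le)// lerB.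
have tt : t - Dh <= t by rewrite gerBl ltW.
have CS := Rintegral_norm_sqr_le tt (input_square_integrable t h0t).
have W := window_sub_le t0t (window_start_le t0t).
have ZD := sqr_predictor_decay t0t.
rewrite dotv_enorm; apply: le_trans (dotv_le_nrm _ _) _; rewrite -expr2.
have i0 : 0 <= \int[mu]_(s in `[t - Dh, t]) `|U s| by apply: Rintegral_ge0 => x _.
move: Xle CS W ZD i0; rewrite opprB addrCA subrr addr0 /state_const.
move: (\int[mu]_(s in `[t - Dh, t]) `|U s|) (\int[mu]_(s in `[t - Dh, t]) (U s ^+ 2)).
move: (decay t) decay_const window_const P (nrm (Z t)) (nrm_ge0 (Z t)) (nrm (X t)) (nrm_ge0 (X t)).
move: (e * nrm B) (mulr_ge0 (ltW e0) (nrm_ge0 B)).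
move=> eb eb0 dt dc wc p z z0 x x0 i i2 Xle CS W ZD i0.
apply: (@le_trans _ _ ((e * (z + eb * i)) ^+ 2)).
  by rewrite !expr2; apply: ler_pM.
have -> : e ^+ 2 * (2 * (n%:R * dc) + 2 * (eb ^+ 2 * (Dh * wc))) * p * dt =
  e ^+ 2 * (2 * (n%:R * dc * p * dt) + 2 * (eb ^+ 2 * (Dh * (wc * p * dt)))) by ring.
rewrite exprMn; apply: ler_wpM2l; first exact: sqr_ge0.
apply: (@le_trans _ _ (2 * z ^+ 2 + 2 * (eb * i) ^+ 2)).
  rewrite -subr_ge0 (_ : _ - _ = (z - eb * i) ^+ 2); first exact: sqr_ge0.
  by ring.
apply: lerD; first by apply: ler_wpM2l.
apply: ler_wpM2l => //; rewrite exprMn; apply: ler_wpM2l; first exact: sqr_ge0.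
by apply: le_trans CS _; apply: ler_wpM2l => //; exact: ltW.
Qed.

(** * Recovering the derivative of the input *)

Hypothesis dU_L2 : forall t, t0 <= t -> square_integrable `[t - Dh, t] (derive1 U).

Lemma derive1_input_ae : {ae mu, forall s, t0 < s ->
  derive1 U s = (K *m (M *m Z s + w s *: G)) 0 0}.
Proof.
apply: filterS X_eq; first exact: (ae_filter_ringOfSetsType mu).
move=> s Xs t0s.
have [_ <-] := is_derive_input t0s (mderiv_predictor t0s (Xs (ltW t0s))).
by rewrite derive1E.
Qed.

(** The delayed input is kept as a square: early on it may be merely [L^2], so it can be bounded
    only after integration. *)
Definition rate_bound s := 2 * (nrm K * nrm M) ^+ 2 * nrm (Z s) ^+ 2 +
  4 * (nrm K * nrm G) ^+ 2 * (U (phi s) ^+ 2 + U (s - Dh) ^+ 2).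

Lemma sqr_rate_le s : (K *m (M *m Z s + w s *: G)) 0 0 ^+ 2 <= rate_bound s.
Proof.
set r := _ 0 0.
have r1 : `|r| <= nrm K * (nrm M * nrm (Z s) + `|w s| * nrm G).
  apply: le_trans (entry_le_nrm _ _ _) _; apply: le_trans (ler_nrmM _ _) _.
  apply: ler_wpM2l; first exact: nrm_ge0.
  by apply: le_trans (ler_nrmD _ _) _; rewrite nrmZ; apply: lerD => //; exact: ler_nrmM.
have wle : `|w s| ^+ 2 <= 2 * (U (phi s) ^+ 2 + U (s - Dh) ^+ 2).
  rewrite real_normK ?num_real// /mismatch -subr_ge0.
  rewrite [leRHS](_ : _ = (U (phi s) + U (s - Dh)) ^+ 2); first exact: sqr_ge0.
  by ring.
rewrite -[r ^+ 2]real_normK ?num_real//.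
apply: (@le_trans _ _ ((nrm K * (nrm M * nrm (Z s) + `|w s| * nrm G)) ^+ 2)).
  by rewrite !expr2; apply: ler_pM.
have := ler_wpM2l (sqr_ge0 (nrm K * nrm G)) wle.
rewrite /rate_bound; move: (nrm K) (nrm M) (nrm G) (nrm (Z s)) `|w s|.
move: (U (phi s) ^+ 2 + U (s - Dh) ^+ 2) => u k mm g z v H1.
have H2 : 0 <= (k * mm * z - k * g * v) ^+ 2 by exact: sqr_ge0.
rewrite -subr_ge0.
have -> : 2 * (k * mm) ^+ 2 * z ^+ 2 + 4 * (k * g) ^+ 2 * u - (k * (mm * z + v * g)) ^+ 2 =
  (k * mm * z - k * g * v) ^+ 2 + 2 * ((k * g) ^+ 2 * (2 * u) - (k * g) ^+ 2 * v ^+ 2) by ring.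
by rewrite addr_ge0// mulr_ge0// subr_ge0.
Qed.

(** The factor 3 is 2 for the change of variables along [phi] plus 1 for the translation by [Dh]. *)
Definition rate_const :=
  2 * (nrm K * nrm M) ^+ 2 * (n%:R * decay_const * window_factor * Dh) +
  4 * (nrm K * nrm G) ^+ 2 * (3 * window_const).

Lemma rate_integral_le c t : t0 <= c -> t - Dh <= c -> c <= t ->
  \int[mu]_(s in `[c, t]) (derive1 U s ^+ 2) <= rate_const * P * decay t.
Proof.
move=> t0c tc ct; have t0t := le_trans t0c ct.
have wh : h0 <= ws t by rewrite le_max lexx.
have wi := sqr_input_integrable t wh.
have W := window_le t0t.
have Zi : mu.-integrable `[c, t] (EFin \o (fun s => nrm (Z s) ^+ 2)).
  have cZ : continuous (fun s => nrm (Z (Num.max t0 s)) ^+ 2).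
    by move=> s; apply: cvgM; exact: (continuous_nrm clamp_predictor_continuous).
  have ZE s : `[c, t]%classic s -> nrm (Z (Num.max t0 s)) ^+ 2 = nrm (Z s) ^+ 2.
    rewrite /= in_itv/= => /andP[cs _].
    by have /max_r -> : t0 <= s by exact: le_trans cs.
  exact: (integrable_congr (measurable_itv _) ZE (continuous_integrable_itv c t cZ)).
have Zle : \int[mu]_(s in `[c, t]) (nrm (Z s) ^+ 2) <=
    n%:R * decay_const * P * (decay t * window_factor) * Dh.
  have q0 : 0 <= n%:R * decay_const * P.
    exact: mulr_ge0 (mulr_ge0 (ler0n _ _) decay_const_ge0) initial_energy_ge0.
  have q1 : 0 <= decay t * window_factor by rewrite mulr_ge0 ?expR_ge0.
  apply: (@le_trans _ _ (n%:R * decay_const * P * (decay t * window_factor) * (t - c))).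
    apply: Rintegral_le_itv => // x cx xt.
    apply: le_trans (sqr_predictor_decay (le_trans t0c cx)) _.
    by apply: ler_wpM2l => //; apply: decay_window; move: tc cx Dh0; lra.
  by apply: ler_wpM2l; [exact: mulr_ge0|move: tc; lra].
have sqU x : `[ws t, t]%classic x -> 0 <= U x ^+ 2 by move=> _; exact: sqr_ge0.
have [i1 U1] : mu.-integrable `[c, t] (EFin \o ((fun s => U s ^+ 2) \o phi)) /\
    \int[mu]_(s in `[c, t]) (U (phi s) ^+ 2) <= 2 * \int[mu]_(s in `[ws t, t]) (U s ^+ 2).
  apply: (@Rintegral_expanding _ phi 2 _ _ (fun s => U s ^+ 2)) => //.
  - exact: delayed_expanding.
  - exact: measurable_delayed.
  - move=> x /=; rewrite in_itv/= => /andP[cx xt].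
    have t0x := le_trans t0c cx.
    apply: delayed_in => //; rewrite /window_start ge_max history_start_le_delayed//=.
    by have := delayed_ge x; move: tc cx Dh0; lra.
have [i2 U2] : mu.-integrable `[c, t] (EFin \o ((fun s => U s ^+ 2) \o (fun s => s - Dh))) /\
    \int[mu]_(s in `[c, t]) (U (s - Dh) ^+ 2) <= 1 * \int[mu]_(s in `[ws t, t]) (U s ^+ 2).
  apply: (@Rintegral_expanding _ (fun s => s - Dh) 1 _ _ (fun s => U s ^+ 2)) => //.
  - by move=> x y _; rewrite mul1r opprB addrA subrK.
  - by apply: continuous_measurable_fun => x; apply: cvgB => //; exact: cvg_cst.
  - move=> x /=; rewrite !in_itv/= => /andP[cx xt].
    rewrite /window_start ge_max; move: history_start_le tc cx xt t0c Dh0 => hs tc cx xt t0c D0.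
    by apply/andP; split; [apply/andP; split; lra|lra].
have i12 := integrable_addr (measurable_itv _) i1 i2.
have bi : mu.-integrable `[c, t] (EFin \o rate_bound).
  by apply: integrable_addr => //; exact: integrable_scaler.
have [mdU dUi] := dU_L2 t0t.
have sub : `[c, t]%classic `<=` `[t - Dh, t]%classic.
  by move=> x /=; rewrite !in_itv/= => /andP[cx ->]; rewrite (le_trans tc).
have dUi' : mu.-integrable `[c, t] (EFin \o (fun s => derive1 U s ^+ 2)).
  by apply: integrableS dUi.
apply: (@le_trans _ _ (\int[mu]_(s in `[c, t]) rate_bound s)).
  rewrite /Rintegral fine_le//; [exact: integrable_fin_num|exact: integrable_fin_num|].
  apply: ae_ge0_le_integral => //.
  - by move=> x _; rewrite lee_fin sqr_ge0.
  - by case/integrableP : dUi'.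
  - by move=> x _; rewrite lee_fin (le_trans (sqr_ge0 _) (sqr_rate_le x)).
  - by case/integrableP : bi.
  - have FF : Filter (nbhs (almost_everywhere mu)) by exact: (ae_filter_ringOfSetsType mu).
    (* The formula for [U'] rests on [U = K Z] on both sides of the point, hence holds only after
       [t0]; the instant [t0] itself is negligible. *)
    have na : mu.-negligible [set t0].
      by apply/negligibleP => //; exact: lebesgue_measure_set1.
    have nt0 : {ae mu, forall x, x != t0}.
      by apply: negligibleS na => x /= /negP; rewrite negbK => /eqP ->.
    apply: filterS2 derive1_input_ae nt0 => x dx xt0; rewrite /= in_itv/= => /andP[cx _].
    rewrite lee_fin dx ?sqr_rate_le// lt_neqAle eq_sym xt0.
    exact: le_trans cx.
have -> : \int[mu]_(s in `[c, t]) rate_bound s =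
    2 * (nrm K * nrm M) ^+ 2 * \int[mu]_(s in `[c, t]) (nrm (Z s) ^+ 2) +
    4 * (nrm K * nrm G) ^+ 2 * (\int[mu]_(s in `[c, t]) (U (phi s) ^+ 2) +
      \int[mu]_(s in `[c, t]) (U (s - Dh) ^+ 2)).
  rewrite /rate_bound RintegralD//; [|exact: integrable_scaler|exact: integrable_scaler].
  by rewrite RintegralZl// RintegralZl// RintegralD.
have -> : rate_const * P * decay t =
    2 * (nrm K * nrm M) ^+ 2 * (n%:R * decay_const * P * (decay t * window_factor) * Dh) +
    4 * (nrm K * nrm G) ^+ 2 * (3 * (window_const * P * decay t)) by rewrite /rate_const; ring.
apply: lerD; apply: ler_wpM2l => //; [by rewrite mulr_ge0 ?sqr_ge0|by rewrite mulr_ge0 ?sqr_ge0|].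
by move: U1 U2 W; lra.
Qed.

Definition initial_rate_energy := \int[mu]_(s in `[t0 - Dh, t0]) (derive1 U s ^+ 2).
Notation Q := initial_rate_energy.

Lemma initial_rate_energy_ge0 : 0 <= Q.
Proof. by apply: Rintegral_ge0 => x _; exact: sqr_ge0. Qed.

Lemma window_factor_ge0 : 0 <= window_factor.
Proof. exact: expR_ge0. Qed.

Lemma window_const_ge0 : 0 <= window_const.
Proof.
apply: mulr_ge0 window_factor_ge0; apply: addr_ge0 => //.
by apply: mulr_ge0 input_const_ge0 _; rewrite mulr_ge0// ltW.
Qed.

Lemma state_const_ge0 : 0 <= state_const.
Proof.
apply: mulr_ge0 (sqr_ge0 _) _; apply: addr_ge0; apply: mulr_ge0 => //.
  exact: mulr_ge0 (ler0n _ _) decay_const_ge0.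
exact: mulr_ge0 (sqr_ge0 _) (mulr_ge0 (ltW Dh0) window_const_ge0).
Qed.

Lemma rate_const_ge0 : 0 <= rate_const.
Proof.
apply: addr_ge0; (apply: mulr_ge0; first by rewrite mulr_ge0 ?sqr_ge0).
  exact: mulr_ge0 (mulr_ge0 (mulr_ge0 (ler0n _ _) decay_const_ge0) window_factor_ge0) (ltW Dh0).
by apply: mulr_ge0 => //; exact: window_const_ge0.
Qed.

(** Before [t0] the derivative of the input is free initial data, bounded through [Q] alone; the
    part after [t0] is controlled by the predictor. *)
Lemma rate_decay t : t0 <= t ->
  \int[mu]_(s in `[t - Dh, t]) (derive1 U s ^+ 2) <=
  (rate_const * P + window_factor * Q) * decay t.
Proof.
move=> t0t; rewrite mulrDl.
have Q0 : 0 <= window_factor * Q * decay t.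
  exact: mulr_ge0 (mulr_ge0 window_factor_ge0 initial_rate_energy_ge0) (expR_ge0 _).
have [t1|t1] := leP t0 (t - Dh).
  apply: le_trans (rate_integral_le t1 (lexx _) _) _; first by move: Dh0; lra.
  by rewrite lerDl.
have [_ dUi] := dU_L2 t0t.
rewrite (Rintegral_itv_split (ltW t1) t0t dUi) addrC; apply: lerD.
  by apply: rate_integral_le => //; exact: ltW.
apply: (@le_trans _ _ Q).
  have [_ dUi0] := dU_L2 (lexx t0).
  apply: Rintegral_le_subset => //.
  - by move=> x /=; rewrite !in_itv/= => /andP[ax ->]; rewrite (le_trans _ ax)// lerB.
  - by move=> x _; exact: sqr_ge0.
rewrite mulrAC (mulrC window_factor) ler_peMl ?initial_rate_energy_ge0//.
by rewrite decay_early//; move: t1 Dh0; lra.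
Qed.

Definition overshoot := state_const + window_const + rate_const + window_factor.

Lemma Pi_L_decay t : t0 <= t ->
  Pi_L Dh dl X U t <= overshoot * Pi_L Dh dl X U t0 * decay t.
Proof.
move=> t0t.
have D0 : 0 <= decay t by exact: expR_ge0.
have S := state_decay t0t; have W := input_window_le t0t; have T := rate_decay t0t.
have -> : Pi_L Dh dl X U t0 = P + Q by [].
rewrite /Pi_L; apply: le_trans (lerD (lerD S W) T) _; rewrite /overshoot.
have P0 := initial_energy_ge0; have Q0 := initial_rate_energy_ge0.
have wf0 := window_factor_ge0; have r0 := rate_const_ge0.
have w0 := window_const_ge0; have s0 := state_const_ge0.
rewrite -!mulrDl; apply: ler_wpM2r => //.
have := mulr_ge0 wf0 P0; have := mulr_ge0 s0 Q0; have := mulr_ge0 w0 Q0; have := mulr_ge0 r0 Q0.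
by move: state_const window_const rate_const window_factor P Q => *; lra.
Qed.

Lemma overshoot_gt0 : 0 < overshoot.
Proof.
have wf0 : 0 < window_factor := lt_le_trans ltr01 window_factor_ge1.
apply: ltr_wpDl => //.
exact: addr_ge0 (addr_ge0 state_const_ge0 window_const_ge0) rate_const_ge0.
Qed.

End Solution.

(** * Choice of the constants *)

Unset Implicit Arguments.

Theorem theorem2 (R : realType) (n : nat) (A : 'M[R]_n) (B : 'cV[R]_n)
    (K : 'rV[R]_n) (Dh t0 : R) (hAK : hurwitz (A + B *m K)) (hDh : 0 < Dh) :
  exists delta1 : R, 0 < delta1 /\
    forall delta delta' : R -> R,
      C1_on `[t0, +oo[ delta delta' ->
      (forall t, t0 <= t -> `|delta t| + `|delta' t| < delta1) ->
      exists C lambda : R, [/\ 0 < C, 0 < lambda &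
        forall (X : R -> 'cV[R]_n) (U : R -> R) (uh : R -> R -> R),
          closed_loop A B K Dh t0 delta X U uh ->
          forall t, t0 <= t ->
            Pi_L Dh delta X U t
              <= C * Pi_L Dh delta X U t0 * expR (- lambda * (t - t0))].
Proof.
have [m [L [al [al0 HL]]]] := hurwitz_lyapunov hAK.
have [e e0 E_le] := expmx_bounded A Dh.
(* This constant involves neither the perturbation nor a solution, so the threshold [d1] can be
   fixed before both. *)
pose c := coupling_const A B K Dh L al.
have c0 : 0 <= c.
  apply: mulr_ge0; last by rewrite mulr_ge0 ?expR_ge0.
  by apply: mulr_ge0 (mismatch_const_ge0 _ _ _ _) (mulr_ge0 (nrm_ge0 _) (nrm_ge0 _)).
(* [1 / 2] bounds the slope of the perturbation and makes the delayed time expanding; [Dh / 2] keeps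
   the delay between [Dh / 2] and [3/2 * Dh]; the last bound gives [2 * d1 * c <= al / 4], with
   [c + 1] because [c] may vanish. *)
pose d1 := Num.min (1 / 2) (Num.min (Dh / 2) (al / (8 * (c + 1)))).
have d1_half : d1 <= 1 / 2 by rewrite ge_min lexx.
have d1_Dh : d1 <= Dh / 2 by rewrite !ge_min lexx orbT.
have c1 : 0 < 8 * (c + 1) by rewrite mulr_gt0// ltr_wpDl.
have d1_al : d1 <= al / (8 * (c + 1)) by rewrite !ge_min lexx !orbT.
have d1_gt0 : 0 < d1 by rewrite !lt_min !divr_gt0.
exists d1; split => // delta delta' Cdelta small.
(* delta is only controlled on [t0, +oo[: freeze it before t0. *)
pose dl t := delta (Num.max t0 t).
have dlE t : t0 <= t -> dl t = delta t by rewrite /dl => /max_r ->.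
have dl_le t : `|dl t| <= d1.
  have t0m : t0 <= Num.max t0 t by rewrite le_max lexx.
  by apply/ltW/(le_lt_trans _ (small _ t0m)); rewrite lerDl.
have dl_lip s t : s <= t -> `|dl t - dl s| <= (t - s) / 2.
  move=> st.
  have d'_le r : t0 <= r -> `|delta' r| <= 1 / 2.
    move=> t0r; apply: le_trans d1_half; apply/ltW/(le_lt_trans _ (small _ t0r)).
    by rewrite lerDr.
  have mm : Num.max t0 s <= Num.max t0 t by rewrite ge_max !le_max lexx st orbT.
  have t0s : t0 <= Num.max t0 s by rewrite le_max lexx.
  apply: le_trans (C1_on_lipschitz Cdelta d'_le t0s mm) _.
  have : Num.max t0 t - Num.max t0 s <= t - s.
    by case: (leP t0 s); case: (leP t0 t); move: st; lra.
  by lra.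
have d1_small : 2 * (d1 * c) < al / 2.
  have : d1 * (8 * (c + 1)) <= al by rewrite -ler_pdivlMr.
  by have := mulr_ge0 (ltW d1_gt0) c0; move: d1_gt0 al0; lra.
have al2 : 0 < al / 2 by rewrite divr_gt0.
exists (overshoot A B K Dh e L al), (al / 2); split => //.
  exact: overshoot_gt0.
move=> X U uh cl t t0t.
(* [Pi_L] reads the perturbation only at the current time, so from [t0] on freezing changes
   nothing. *)
have PiE s : t0 <= s -> Pi_L Dh delta X U s = Pi_L Dh dl X U s.
  by move=> t0s; rewrite /Pi_L -(dlE s t0s).
rewrite !PiE//.
case: cl => X_ac U_ac U_L2 dU_L2 X_eq _ U_eq.
apply: (Pi_L_decay (d1 := d1)) => //.
- by have := U_L2 t0 (lexx t0); rewrite /history_start -(dlE t0 (lexx t0)).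
- apply: filterS X_eq; first exact: (ae_filter_ringOfSetsType lebesgue_measure).
  move=> s Xs t0s; apply: mderiv_of_is_derive.
  by rewrite /delayed dlE//; exact: Xs.
- by move=> x; have [] := HL x.
- by move=> x; have [] := HL x.
Qed.
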